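(* Let $(X,0)=(X_1,0)\cup(X_2,0)\subset(k^n,0)$, where $(X_i,0)=\{f_i=0\}$ can be further reducible or non-reduced, but without common components. Let $(X',0)=(X_1,0)\coprod(X_2,0)\to(X,0)$ be the finite modification that separates the components. Let $E$ be the kernel module of a determinantal representation $\mathcal{M}$ of $(X,0)$. The following are equivalent: (1) $E$ is $X'/X$-saturated. (1') $\mathcal{M}$ is $X'/X$-saturated, i.e. every element of $\mathcal{M}^\vee$ belongs to the ideal $\langle f_1,f_2\rangle\subset\mathcal{O}$. (2) $E=E_1\oplus E_2$, where $E_i=E|_{(X_i,0)}/\mathrm{Torsion}$. (2') $\mathcal{M}\sim\mathcal{M}_1\oplus\mathcal{M}_2$, where $\mathcal{M}_i$ is a determinantal representation of $(X_i,0)$.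
   Context: $k$ is an algebraically closed, normed, complete field of characteristic zero; $\mathcal{O}=\mathcal{O}_{(k^n,0)}$ is either $k\{x_1,\dots,x_n\}$ (locally convergent power series) or $k[[x_1,\dots,x_n]]$. Hypersurface germs $\{f=0\}$ are taken with multiplicities: $\mathcal{O}_{(X,0)}=\mathcal{O}/(f_1f_2)$, $\mathcal{O}_{(X_i,0)}=\mathcal{O}/(f_i)$. The modification $\nu:(X',0)\to(X,0)$ corresponds to the ring inclusion $\mathcal{O}_{(X,0)}\hookrightarrow\mathcal{O}_{(X',0)}=\mathcal{O}_{(X_1,0)}\times\mathcal{O}_{(X_2,0)}$. A determinantal representation of $\{f=0\}$ is a square matrix over $\mathcal{O}$, vanishing at the origin, whose determinant is $f$ up to a unit (the given $\mathcal{M}$ has size $d>1$; the blocks $\mathcal{M}_i$ may have size one); $\mathcal{M}^\vee$ is the adjoint (adjugate) matrix. Local equivalence: $\mathcal{M}\sim A\mathcal{M}B$ with $A,B\in GL(d,\mathcal{O})$. The kernel module $E$ of $\mathcal{M}$ is the $\mathcal{O}_{(X,0)}$-submodule of $\mathcal{O}_{(X,0)}^{\oplus d}$ generated by the columns of $\mathcal{M}^\vee$. $E|_{(X_i,0)}/\mathrm{Torsion}=(E\otimes\mathcal{O}_{(X_i,0)})/\mathrm{Torsion}$. A torsion-free $\mathcal{O}_{(X,0)}$-module $E$ is $X'/X$-saturated if the natural embedding $E\hookrightarrow\nu_*(\nu^*E/\mathrm{Torsion})$ is an isomorphism, where $\nu^*E=E\otimes_{\mathcal{O}_{(X,0)}}\mathcal{O}_{(X',0)}$.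 A determinantal representation $\mathcal{M}$ is $X'/X$-saturated if every entry of $\mathcal{M}^\vee$ belongs to the relative adjoint ideal $Adj_{X'/X}=\{g\in\mathcal{O}:\ g\,\nu_*\mathcal{O}_{(X',0)}\subset\mathcal{O}_{(X,0)}\}$, which for this modification equals $\langle f_1,f_2\rangle$. *)

(* Defs.v *)
From HB Require Import structures.
From mathcomp Require Import all_boot all_order all_algebra ring_quotient.
From mathcomp Require Import boolp reals.
From mathcomp Require Import mpoly freeg.

Set Implicit Arguments.
Unset Strict Implicit.
Unset Printing Implicit Defensive.

Import Order.TTheory GRing.Theory Num.Theory.
Local Open Scope ring_scope.
Local Open Scope quotient_scope.

(* A multiplicative norm on a field for which the field is complete.  MathComp's
   normedZmodType demands |x *+ n| = |x| *+ n and MathComp-Analysis norms live in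
   an ordered field of scalars, so neither covers fields such as C_p. *)
Record complete_norm (R : realType) (k : fieldType) := CompleteNorm {
  nrm :> k -> R;
  nrm_ge0 : forall x, 0 <= nrm x;
  nrm_eq0 : forall x, nrm x = 0 <-> x = 0;
  nrmM : forall x y, nrm (x * y) = nrm x * nrm y;
  nrmD : forall x y, nrm (x + y) <= nrm x + nrm y;
  nrm_complete : forall u : nat -> k,
    (forall e : R, 0 < e -> exists N, forall i j, (N <= i)%N -> (N <= j)%N ->
      nrm (u i - u j) < e) ->
    exists l, forall e : R, 0 < e -> exists N, forall i, (N <= i)%N ->
      nrm (u i - l) < e
}.

Section NormTheory.
Variables (R : realType) (k : fieldType) (v : complete_norm R k).

Lemma nrm0 : v 0 = 0. Proof. exact/nrm_eq0. Qed.

Lemma nrm1 : v 1 = 1.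
Proof.
have v1 : v 1 != 0 by apply/eqP => /nrm_eq0/eqP; rewrite oner_eq0.
by apply: (mulfI v1); rewrite mulr1 -nrmM mulr1.
Qed.

Lemma nrmN x : v (- x) = v x.
Proof.
suff vN1 : v (-1) = 1 by rewrite -mulN1r nrmM vN1 mul1r.
have : v (-1) ^+ 2 == 1 by rewrite expr2 -nrmM mulrNN mulr1 nrm1.
rewrite sqrf_eq1 => /orP[/eqP//|/eqP vN1].
by have := nrm_ge0 v (-1); rewrite vN1 oppr_ge0 ler10.
Qed.

Lemma nrm_sum (I : finType) (P : pred I) (F : I -> k) :
  v (\sum_(i | P i) F i) <= \sum_(i | P i) v (F i).
Proof.
elim/big_rec2: _ => [|i y x _ le_xy]; first by rewrite nrm0.
by apply: le_trans (nrmD v _ _) _; rewrite lerD2l.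
Qed.

End NormTheory.

(* In the presence of choice every commutative ring has decidable units. *)
Section ClassicalUnit.
Variable R : comNzRingType.

Definition cunit : {pred R} := fun x => `[< exists y, y * x = 1 >].
Definition cinv (x : R) : R :=
  if pselect (exists y, y * x = 1) is left h then sval (cid h) else x.

Lemma cmulVr : {in cunit, left_inverse 1 cinv *%R}.
Proof.
move=> x /asboolP ux; rewrite /cinv.
by case: pselect => [h|//]; case: cid.
Qed.

Lemma cunitPl x y : y * x = 1 -> cunit x.
Proof. by move=> yx; apply/asboolP; exists y. Qed.

Lemma cinv_out : {in [predC cunit], cinv =1 id}.
Proof.
move=> x; rewrite inE /= => /asboolPn ux; rewrite /cinv.
by case: pselect.
Qed.

End ClassicalUnit.

Section FormalPowerSeries.
Variable n : nat.

Record fps (A : Type) := Fps { fcoef : 'X_{1..n} -> A }.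

Section Zmod.
Variable A : zmodType.
Notation fps := (fps A).

HB.instance Definition _ := [isNew for @fcoef A].
HB.instance Definition _ := [Choice of fps by <:].

Lemma fpsP (f g : fps) : (forall m, fcoef f m = fcoef g m) -> f = g.
Proof. by case: f g => [f] [g] /= /funext->. Qed.

Definition fps0 : fps := Fps (fun=> 0).
Definition fps_add (f g : fps) := Fps (fun m => fcoef f m + fcoef g m).
Definition fps_opp (f : fps) := Fps (fun m => - fcoef f m).

Fact fps_addA : associative fps_add.
Proof. by move=> f g h; apply: fpsP => m /=; rewrite addrA. Qed.
Fact fps_addC : commutative fps_add.
Proof. by move=> f g; apply: fpsP => m /=; rewrite addrC. Qed.
Fact fps_add0 : left_id fps0 fps_add.
Proof. by move=> f; apply: fpsP => m /=; rewrite add0r. Qed.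
Fact fps_addN : left_inverse fps0 fps_opp fps_add.
Proof. by move=> f; apply: fpsP => m /=; rewrite addNr. Qed.

HB.instance Definition _ :=
  GRing.isZmodule.Build fps fps_addA fps_addC fps_add0 fps_addN.

End Zmod.

Section Ring.
Variable A : comNzRingType.
Notation fps := (fps A).
Implicit Types (f g h : fps) (m : 'X_{1..n}).

Definition fps1 : fps := Fps (fun m => (m == 0%MM)%:R).
Definition fps_mul f g : fps := Fps (fun m =>
  \sum_(l : 'X_{1..n < (mdeg m).+1, (mdeg m).+1} | m == (l.1 + l.2)%MM)
     fcoef f l.1 * fcoef g l.2).

Definition fps_trunc N f : {mpoly A[n]} :=
  \sum_(m : 'X_{1..n < N}) fcoef f m *: 'X_[m].

Definition fps_agree N f (p : {mpoly A[n]}) :=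
  forall m, (mdeg m < N)%N -> p@_m = fcoef f m.

Lemma fps_truncP N f : fps_agree N f (fps_trunc N f).
Proof.
move=> m lt_mN; rewrite /fps_trunc raddf_sum /=.
rewrite (bigD1 (BMultinom lt_mN)) //= mcoeffZ mcoeffX eqxx mulr1.
rewrite big1 ?addr0 // => l /negPf ne_l.
by rewrite mcoeffZ mcoeffX [_ == m]ne_l mulr0.
Qed.

Lemma fps_agreeM N f g p q :
  fps_agree N f p -> fps_agree N g q -> fps_agree N (fps_mul f g) (p * q).
Proof.
move=> fp gq m lt_mN; rewrite mcoeffM /=; apply: eq_bigr => -[l1 l2] /= _.
by rewrite fp ?gq //; apply: leq_trans lt_mN; apply: bmdeg.
Qed.

Lemma fps_agree1 N : fps_agree N fps1 1.
Proof. by move=> m _; rewrite mcoeff1. Qed.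

Lemma fps_agreeP f g :
  (forall N, exists2 p, fps_agree N f p & fps_agree N g p) -> f = g.
Proof.
move=> fg; apply: fpsP => m; have [p fp gp] := fg (mdeg m).+1.
by rewrite -fp // gp.
Qed.

Fact fps_mulA : associative fps_mul.
Proof.
move=> f g h; apply: fps_agreeP => N.
exists (fps_trunc N f * (fps_trunc N g * fps_trunc N h)); last rewrite mulrA.
  by do 2?[apply: fps_agreeM; try exact: fps_truncP].
by do 2?[apply: fps_agreeM; try exact: fps_truncP].
Qed.

Fact fps_mulC : commutative fps_mul.
Proof.
move=> f g; apply: fps_agreeP => N.
exists (fps_trunc N f * fps_trunc N g); last rewrite mulrC.
  by apply: fps_agreeM; apply: fps_truncP.
by apply: fps_agreeM; apply: fps_truncP.
Qed.

Fact fps_mul1 : left_id fps1 fps_mul.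
Proof.
move=> f; apply: fps_agreeP => N; exists (1 * fps_trunc N f).
  by apply: fps_agreeM; [apply: fps_agree1 | apply: fps_truncP].
by rewrite mul1r; apply: fps_truncP.
Qed.

Fact fps_mulDl : left_distributive fps_mul +%R.
Proof.
move=> f g h; apply: fpsP => m /=.
by rewrite -big_split; apply: eq_bigr => l _ /=; rewrite mulrDl.
Qed.

Fact fps_1neq0 : fps1 != 0.
Proof.
apply/eqP => /(congr1 (fun f => fcoef f 0%MM)) /= /eqP.
by rewrite eqxx oner_eq0.
Qed.

HB.instance Definition _ := GRing.Zmodule_isComNzRing.Build fps
  fps_mulA fps_mulC fps_mul1 fps_mulDl fps_1neq0.
HB.instance Definition _ := GRing.ComNzRing_hasMulInverse.Build fps
  (@cmulVr fps) (@cunitPl fps) (@cinv_out fps).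

Lemma fps_coefB f g m : fcoef (f - g) m = fcoef f m - fcoef g m.
Proof. by []. Qed.

Lemma fps_coef1 m : fcoef (1 : fps) m = (m == 0%MM)%:R.
Proof. by []. Qed.

Lemma fps_coefM f g m : fcoef (f * g) m =
  \sum_(l : 'X_{1..n < (mdeg m).+1, (mdeg m).+1} | m == (l.1 + l.2)%MM)
     fcoef f l.1 * fcoef g l.2.
Proof. by []. Qed.

Lemma fps_coefMw N f g m : (mdeg m < N)%N -> fcoef (f * g) m =
  \sum_(l : 'X_{1..n < N, N} | m == (l.1 + l.2)%MM) fcoef f l.1 * fcoef g l.2.
Proof.
move=> lt_mN.
rewrite -(fps_agreeM (@fps_truncP N f) (@fps_truncP N g) lt_mN).
rewrite (mcoeff_poly_mul _ _ lt_mN) /=; apply: eq_bigr => -[l1 l2] /= _.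
by rewrite !fps_truncP // bmdeg.
Qed.

End Ring.
End FormalPowerSeries.

(* The ring k{x_1, ..., x_n}: series converging absolutely on some polydisc
   around the origin. *)
Section ConvergentPowerSeries.
Variables (R : realType) (k : fieldType) (v : complete_norm R k) (n : nat).

Definition convergent (f : fps n k) : Prop :=
  exists2 r : R, 0 < r & exists C : R, forall N : nat,
    \sum_(m : 'X_{1..n < N}) v (fcoef f m) * r ^+ mdeg m <= C.

Definition convergentb : {pred fps n k} := fun f => `[< convergent f >].

Lemma convergent_common f g : convergent f -> convergent g ->
  exists2 r : R, 0 < r & exists Cf Cg : R, forall N : nat,
    (\sum_(m : 'X_{1..n < N}) v (fcoef f m) * r ^+ mdeg m <= Cf) /\
    (\sum_(m : 'X_{1..n < N}) v (fcoef g m) * r ^+ mdeg m <= Cg).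
Proof.
move=> [r r0 [C hC]] [s s0 [D hD]].
set t := Num.min r s; have t0 : 0 < t by rewrite lt_min r0.
have tr : t <= r by rewrite ge_min lexx.
have ts : t <= s by rewrite ge_min lexx orbT.
exists t => //.
exists C, D => N; split.
- apply: le_trans (hC N); apply: ler_sum => m _.
  by rewrite ler_wpM2l ?nrm_ge0 // lerXn2r ?nnegrE ?(ltW t0) ?(ltW r0).
- apply: le_trans (hD N); apply: ler_sum => m _.
  by rewrite ler_wpM2l ?nrm_ge0 // lerXn2r ?nnegrE ?(ltW t0) ?(ltW s0).
Qed.

Fact convergent_subring : subring_closed convergentb.
Proof.
split=> [|f g /asboolP cf /asboolP cg|f g /asboolP cf /asboolP cg];
  apply/asboolP.
- exists 1 => //; exists 1 => -[|N].
    by rewrite big1 // => -[m m0]; have := m0; rewrite ltn0.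
  rewrite (bigD1 (bm0 : 'X_{1..n < N.+1})) //= big1 ?addr0 => [|m].
    by rewrite mdeg0 mulr1 eqxx nrm1.
  by rewrite -val_eqE /= => /negPf ->; rewrite nrm0 mul0r.
- have [r r0 [C [D hCD]]] := convergent_common cf cg.
  exists r => //; exists (C + D) => N; have [hC hD] := hCD N.
  apply: le_trans (lerD hC hD); rewrite -big_split /=; apply: ler_sum => m _.
  rewrite -mulrDl ler_wpM2r ?exprn_ge0 ?(ltW r0) // -(nrmN v (fcoef g m)).
  exact: nrmD.
have [r r0 [C [D hCD]]] := convergent_common cf cg.
exists r => //; exists (C * D) => N; have [hC hD] := hCD N.
have ge0 h (m : 'X_{1..n}) : 0 <= v (fcoef h m) * r ^+ mdeg m.
  by rewrite mulr_ge0 ?nrm_ge0 ?exprn_ge0 ?ltW.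
apply: le_trans (ler_pM _ _ hC hD); try by apply: sumr_ge0.
pose F (l : 'X_{1..n < N, N}) := (v (fcoef f l.1) * r ^+ mdeg l.1) *
                                 (v (fcoef g l.2) * r ^+ mdeg l.2).
apply: (@le_trans _ _ (\sum_(m : 'X_{1..n < N})
    \sum_(l : 'X_{1..n < N, N} | bmnm m == (l.1 + l.2)%MM) F l)).
  apply: ler_sum => m _; rewrite (fps_coefMw _ _ (bmdeg m)).
  apply: le_trans (ler_wpM2r _ (nrm_sum v _ _)) _; first by rewrite exprn_ge0 ?ltW.
  rewrite mulr_suml; apply: ler_sum => l /eqP ->.
  by rewrite nrmM mdegD exprD mulrACA.
rewrite mulr_suml [leRHS](eq_bigr (fun a : 'X_{1..n < N} =>
  \sum_(b : 'X_{1..n < N}) F (a, b))) => [|a _]; last by rewrite mulr_sumr.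
rewrite pair_bigA /= (exchange_big_dep predT) //=; apply: ler_sum => -[a b] _.
rewrite sumr_const -[leRHS]mulr1n ler_wpMn2l //; first by rewrite mulr_ge0 ?ge0.
apply/card_le1_eqP => m m'; rewrite !unfold_in => /eqP mE /eqP m'E.
by do 3![apply: val_inj]; rewrite /= mE m'E.
Qed.

HB.instance Definition _ :=
  GRing.isSubringClosed.Build (fps n k) convergentb convergent_subring.

Record cps := Cps { cps_val :> fps n k; _ : cps_val \in convergentb }.

HB.instance Definition _ := [isSub for cps_val].
HB.instance Definition _ := [Choice of cps by <:].
HB.instance Definition _ := [SubChoice_isSubComNzRing of cps by <:].
HB.instance Definition _ := GRing.ComNzRing_hasMulInverse.Build cps
  (@cmulVr cps) (@cunitPl cps) (@cinv_out cps).

End ConvergentPowerSeries.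

Variant series_kind := Convergent | Formal.

Section GermRing.
Variables (R : realType) (k : fieldType) (v : complete_norm R k).

Definition germ_ring (kd : series_kind) (n : nat) : comUnitRingType :=
  match kd with
  | Convergent => cps v n
  | Formal => fps n k
  end.

Definition germ_series kd n : germ_ring kd n -> fps n k :=
  match kd with
  | Convergent => @cps_val R k v n
  | Formal => id
  end.

Definition at_origin kd n (f : germ_ring kd n) : k :=
  fcoef (germ_series f) 0%MM.

End GermRing.

(* V / <P>, the quotient of a module by the submodule generated by P. *)
Section ModuleQuotient.
Variables (R : pzRingType) (V : lmodType R) (P : V -> Prop).

Definition span (x : V) : Prop := forall W : V -> Prop,
  W 0 -> (forall a u w, W u -> W w -> W (a *: u + w)) ->
  (forall u, P u -> W u) -> W x.

Lemma span_gen x : P x -> span x.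
Proof. by move=> Px W _ _; apply. Qed.

Lemma span0 : span 0. Proof. by move=> W. Qed.

Lemma spanP a u w : span u -> span w -> span (a *: u + w).
Proof.
by move=> su sw W W0 WP WS; exact: (WP _ _ _ (su W W0 WP WS) (sw W W0 WP WS)).
Qed.

Lemma spanZ a u : span u -> span (a *: u).
Proof. by move=> su; rewrite -[_ *: _]addr0; exact: (spanP a su span0). Qed.

Lemma spanD u w : span u -> span w -> span (u + w).
Proof. by move=> su sw; rewrite -[u]scale1r; exact: (spanP 1 su sw). Qed.

Lemma spanB u w : span u -> span w -> span (u - w).
Proof. by move=> su sw; rewrite addrC -scaleN1r; exact: (spanP (-1) sw su). Qed.

Definition spanb : {pred V} := fun x => `[< span x >].

Fact spanb_zmod : zmod_closed spanb.
Proof.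
split=> [|u w /asboolP su /asboolP sw]; apply/asboolP; first exact: span0.
exact: spanB.
Qed.

HB.instance Definition _ := GRing.isZmodClosed.Build V spanb spanb_zmod.

Definition mquot : Type := (Quotient.quot spanb).
HB.instance Definition _ := GRing.Zmodule.on mquot.

Definition mclass (x : V) : mquot := \pi_(Quotient.quot spanb) x.

Lemma mclassB : zmod_morphism mclass.
Proof. exact: (pi_is_zmod_morphism (Quotient.quot spanb)). Qed.

HB.instance Definition _ := GRing.isZmodMorphism.Build V mquot mclass mclassB.

Definition mrepr (x : mquot) : V := repr (x : (Quotient.quot spanb)).

Lemma mreprK : cancel mrepr mclass.
Proof. by move=> x; rewrite /mclass /mrepr reprK. Qed.

Lemma mclass_eq x y : mclass x = mclass y <-> span (x - y).
Proof.
split=> [/eqmodP/asboolP //|sxy].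
exact/eqmodP/asboolP.
Qed.

Lemma mclass_repr x : span (mrepr (mclass x) - x).
Proof. by apply/mclass_eq; rewrite mreprK. Qed.

Definition mscale (a : R) (x : mquot) : mquot := mclass (a *: mrepr x).

Lemma mscaleE a x : mscale a (mclass x) = mclass (a *: x).
Proof. by apply/mclass_eq; rewrite -scalerBr; exact: (spanZ a (mclass_repr x)). Qed.

Fact mscaleA a b x : mscale a (mscale b x) = mscale (a * b) x.
Proof. by rewrite -[x]mreprK !mscaleE scalerA. Qed.
Fact mscale1 : left_id 1 mscale.
Proof. by move=> x; rewrite -[x]mreprK !mscaleE scale1r. Qed.
Fact mscaleDr : right_distributive mscale +%R.
Proof.
move=> a x y; rewrite -[x]mreprK -[y]mreprK -raddfD !mscaleE -raddfD.
by rewrite scalerDr.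
Qed.
Fact mscaleDl x : {morph mscale^~ x : a b / a + b}.
Proof. by move=> a b; rewrite -[x]mreprK !mscaleE -raddfD scalerDl. Qed.

HB.instance Definition _ := GRing.Zmodule_isLmodule.Build R mquot
  mscaleA mscale1 mscaleDr mscaleDl.

Lemma mclassZ : scalable mclass.
Proof. by move=> a x; rewrite -[RHS]/(mscale a _) mscaleE. Qed.

HB.instance Definition _ := GRing.isScalable.Build R V mquot *:%R mclass mclassZ.

End ModuleQuotient.

(* R / (f) *)
Section PrincipalQuotient.
Variables (R : comPzRingType) (f : R).

Definition rquot : Type := mquot (fun x : R^o => x = f).
HB.instance Definition _ := GRing.Zmodule.on rquot.

Definition rclass (x : R) : rquot := mclass (fun x : R^o => x = f) x.
Definition rrepr (x : rquot) : R := mrepr x.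

Lemma rreprK : cancel rrepr rclass. Proof. exact: mreprK. Qed.

Lemma rclass_eq x y : rclass x = rclass y <-> exists c, x - y = c * f.
Proof.
rewrite /rclass mclass_eq; split=> [|[c ->]]; last first.
  by exact: (@spanZ R R^o _ c f (span_gen _)).
move=> sxy; apply: (sxy (fun z => exists c, z = c * f)).
- by exists 0; rewrite mul0r.
- move=> a u w [c ->] [e ->].
  by exists (a * c + e); rewrite mulrDl -mulrA.
by move=> u ->; exists 1; rewrite mul1r.
Qed.

Lemma rclassB : zmod_morphism rclass. Proof. exact: (@mclassB R R^o). Qed.
HB.instance Definition _ := GRing.isZmodMorphism.Build R rquot rclass rclassB.

Definition rquot1 : rquot := rclass 1.
Definition rquot_mul (x y : rquot) : rquot := rclass (rrepr x * rrepr y).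

Lemma rquot_mulE x y : rquot_mul (rclass x) (rclass y) = rclass (x * y).
Proof.
have [c xE] := (rclass_eq (rrepr (rclass x)) x).1 (rreprK _).
have [e yE] := (rclass_eq (rrepr (rclass y)) y).1 (rreprK _).
apply/rclass_eq; exists (c * rrepr (rclass y) + x * e).
rewrite mulrDl mulrAC -xE -mulrA -yE mulrBl mulrBr addrA.
by rewrite subrK.
Qed.

Fact rquot_mulA : associative rquot_mul.
Proof.
by move=> x y z; rewrite -[x]rreprK -[y]rreprK -[z]rreprK !rquot_mulE mulrA.
Qed.
Fact rquot_mulC : commutative rquot_mul.
Proof. by move=> x y; rewrite -[x]rreprK -[y]rreprK !rquot_mulE mulrC. Qed.
Fact rquot_mul1 : left_id rquot1 rquot_mul.
Proof. by move=> x; rewrite -[x]rreprK !rquot_mulE mul1r. Qed.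
Fact rquot_mulDl : left_distributive rquot_mul +%R.
Proof.
move=> x y z; rewrite -[x]rreprK -[y]rreprK -[z]rreprK -raddfD !rquot_mulE.
by rewrite -raddfD mulrDl.
Qed.

HB.instance Definition _ := GRing.Zmodule_isComPzRing.Build rquot
  rquot_mulA rquot_mulC rquot_mul1 rquot_mulDl.

Lemma rclassM : monoid_morphism rclass.
Proof. by split=> // x y; rewrite -[RHS]/(rquot_mul _ _) rquot_mulE. Qed.
HB.instance Definition _ := GRing.isMonoidMorphism.Build R rquot rclass rclassM.

End PrincipalQuotient.

Section Restriction.
Variables (R : comPzRingType) (f g : R) (gf : exists c, f = c * g).

(* the restriction map R/(f) -> R/(g) when g divides f *)
Definition rres of (exists c, f = c * g) := fun x : rquot f => rclass g (rrepr x).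

Lemma rresE x : rres gf (rclass f x) = rclass g x.
Proof.
have [c xE] := (rclass_eq f (rrepr (rclass f x)) x).1 (rreprK _).
have [e fE] := gf.
by apply/rclass_eq; exists (c * e); rewrite xE fE mulrA.
Qed.

Lemma rresB : zmod_morphism (rres gf).
Proof.
move=> x y; rewrite -[x]rreprK -[y]rreprK -raddfB !rresE.
exact: raddfB.
Qed.
Lemma rresM : monoid_morphism (rres gf).
Proof.
split=> [|x y]; first exact: (rresE 1).
by rewrite -[x]rreprK -[y]rreprK -rmorphM !rresE rmorphM.
Qed.
HB.instance Definition _ :=
  GRing.isZmodMorphism.Build (rquot f) (rquot g) (rres gf) rresB.
HB.instance Definition _ :=
  GRing.isMonoidMorphism.Build (rquot f) (rquot g) (rres gf) rresM.

End Restriction.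

(* Restriction of scalars along phi. *)
Definition restr (R S : pzRingType) (phi : {rmorphism R -> S}) (V : lmodType S)
  : Type := V.

Section RestrictionOfScalars.
Variables (R S : pzRingType) (phi : {rmorphism R -> S}) (V : lmodType S).

HB.instance Definition _ := GRing.Zmodule.on (restr phi V).

Definition restr_scale (a : R) (x : restr phi V) : restr phi V :=
  phi a *: (x : V).

Fact restr_scaleA a b x : restr_scale a (restr_scale b x) = restr_scale (a * b) x.
Proof. by rewrite /restr_scale scalerA rmorphM. Qed.
Fact restr_scale1 : left_id 1 restr_scale.
Proof. by move=> x; rewrite /restr_scale rmorph1 scale1r. Qed.
Fact restr_scaleDr : right_distributive restr_scale +%R.
Proof. by move=> a x y; rewrite /restr_scale scalerDr. Qed.
Fact restr_scaleDl x : {morph restr_scale^~ x : a b / a + b}.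
Proof. by move=> a b; rewrite /restr_scale rmorphD scalerDl. Qed.

HB.instance Definition _ := GRing.Zmodule_isLmodule.Build R (restr phi V)
  restr_scaleA restr_scale1 restr_scaleDr restr_scaleDl.

End RestrictionOfScalars.

(* E (x)_R S for an R-algebra phi : R -> S: the free abelian group on E * S
   modulo the bilinear relations, with S acting on the second factor. *)
Section Tensor.
Variables (R S : comPzRingType) (phi : {rmorphism R -> S}) (E : lmodType R).

Let gen (e : E) (s : S) : {freeg (E * S)%type / int} := << (e, s) >>.

Variant tens_rel : {freeg (E * S)%type / int} -> Prop :=
| TensDl e e' s : tens_rel (gen (e + e') s - gen e s - gen e' s)
| TensDr e s s' : tens_rel (gen e (s + s') - gen e s - gen e s')
| TensZ r e s : tens_rel (gen (r *: e) s - gen e (phi r * s)).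

Definition tensor : Type := mquot tens_rel.
HB.instance Definition _ := GRing.Zmodule.on tensor.

Definition tens (e : E) (s : S) : tensor := mclass tens_rel (gen e s).

Definition tens_act (a : S) : {freeg (E * S)%type / int} -> _ :=
  fglift (fun x => gen x.1 (a * x.2)).

Lemma tens_actB a : zmod_morphism (tens_act a).
Proof. exact: lift_is_additive. Qed.
HB.instance Definition _ a := GRing.isZmodMorphism.Build _ _ _ (tens_actB a).

Lemma tens_act_gen a e s : tens_act a (gen e s) = gen e (a * s).
Proof. by rewrite /tens_act liftU scale1r. Qed.

Lemma freeg_gen_ind (W : {freeg (E * S)%type / int} -> Prop) :
  W 0 -> (forall e s, W (gen e s)) -> (forall x y, W x -> W y -> W (x - y)) ->
  forall x, W x.
Proof.
move=> W0 Wg WB.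
have WN x : W x -> W (- x) by move=> Wx; rewrite -sub0r; apply: WB.
have WD x y : W x -> W y -> W (x + y).
  by move=> Wx Wy; rewrite -[y]opprK; apply/WB/WN.
have Wn x i : W x -> W (x *+ i).
  by move=> Wx; elim: i => // i IH; rewrite mulrS; apply: WD.
move=> x; rewrite -[x]freeg_sumE; elim/big_ind: _ => // -[e s] _.
have -> c : << c *g (e, s) >> = gen e s *~ c :> {freeg (E * S)%type / int}.
  by apply/eqP/freeg_eqP => y; rewrite raddfMz /= !coeffU mul1r mulrzz mulrC.
by case: (coeff _ _) => i; [apply: Wn | apply/WN/Wn].
Qed.

Lemma tens_ind (W : tensor -> Prop) :
  W 0 -> (forall e s, W (tens e s)) -> (forall x y, W x -> W y -> W (x - y)) ->
  forall x, W x.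
Proof.
move=> W0 Wg WB x; rewrite -[x]mreprK.
elim/freeg_gen_ind: (mrepr x) => [|e s|y z Wy Wz]; first by rewrite raddf0.
  exact: Wg.
by rewrite raddfB; apply: WB.
Qed.

Lemma tens_act_span a x : span tens_rel x -> span tens_rel (tens_act a x).
Proof.
move=> sx; apply: (sx (fun x => span tens_rel (tens_act a x))).
- by rewrite raddf0; apply: span0.
- move=> c u w su sw; rewrite raddfD /= -[c]intz scaler_int raddfMz.
  by rewrite -scaler_int; apply: spanP.
move=> _ [e e' s|e s s'|r e s]; rewrite !raddfB /= !tens_act_gen;
  apply: span_gen; rewrite ?mulrDr; first exact: TensDl; first exact: TensDr.
by rewrite mulrCA; apply: TensZ.
Qed.

Definition tens_scale (a : S) (x : tensor) : tensor :=
  mclass tens_rel (tens_act a (mrepr x)).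

Lemma tens_scaleE a x :
  tens_scale a (mclass tens_rel x) = mclass tens_rel (tens_act a x).
Proof.
by apply/mclass_eq; rewrite -raddfB; exact: (tens_act_span a (mclass_repr x)).
Qed.

Lemma tens_scale_tens a e s : tens_scale a (tens e s) = tens e (a * s).
Proof. by rewrite tens_scaleE tens_act_gen. Qed.

Fact tens_scaleDr : right_distributive tens_scale +%R.
Proof.
move=> a x y; rewrite -[x]mreprK -[y]mreprK -raddfD !tens_scaleE -raddfD.
by rewrite /= -raddfD.
Qed.

Lemma tens_scaleB a x y : tens_scale a (x - y) = tens_scale a x - tens_scale a y.
Proof.
by apply/eqP; rewrite eq_sym subr_eq -tens_scaleDr subrK.
Qed.

Lemma tens_scale0 a : tens_scale a 0 = 0.
Proof. by rewrite -[X in tens_scale a X](subrr 0) tens_scaleB subrr. Qed.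

Lemma tensDr e s s' : tens e (s + s') = tens e s + tens e s'.
Proof.
rewrite /tens -raddfD; apply/mclass_eq; apply: span_gen.
by rewrite opprD addrA; apply: TensDr.
Qed.

Lemma tensDl e e' s : tens (e + e') s = tens e s + tens e' s.
Proof.
rewrite /tens -raddfD; apply/mclass_eq; apply: span_gen.
by rewrite opprD addrA; apply: TensDl.
Qed.

Lemma tensZl r e s : tens (r *: e) s = tens e (phi r * s).
Proof. by apply/mclass_eq; apply: span_gen; apply: TensZ. Qed.

Fact tens_scaleA a b x : tens_scale a (tens_scale b x) = tens_scale (a * b) x.
Proof.
elim/tens_ind: x => [|e s|x y IHx IHy]; first by rewrite !tens_scale0.
  by rewrite !tens_scale_tens mulrA.
by rewrite !tens_scaleB IHx IHy.
Qed.
Fact tens_scale1 : left_id 1 tens_scale.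
Proof.
elim/tens_ind => [|e s|x y IHx IHy]; first by rewrite !tens_scale0.
  by rewrite !tens_scale_tens mul1r.
by rewrite !tens_scaleB IHx IHy.
Qed.
Fact tens_scaleDl x : {morph tens_scale^~ x : a b / a + b}.
Proof.
move=> a b; elim/tens_ind: x => [|e s|x y IHx IHy].
- by rewrite !tens_scale0 addr0.
- by rewrite !tens_scale_tens mulrDl tensDr.
by rewrite !tens_scaleB IHx IHy opprD addrACA.
Qed.

HB.instance Definition _ := GRing.Zmodule_isLmodule.Build S tensor
  tens_scaleA tens_scale1 tens_scaleDr tens_scaleDl.

End Tensor.

(* Torsion elements are those killed by a non-zero-divisor of the ring; they
   form a submodule, so the quotient is by the set of torsion elements itself. *)
Section Torsion.
Variables (S : comPzRingType) (V : lmodType S).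

Definition torsion (x : V) : Prop := exists2 s : S, GRing.lreg s & s *: x = 0.

Lemma torsion_span x : span torsion x <-> torsion x.
Proof.
split=> [|tx]; last exact: span_gen.
move=> sx; apply: (sx torsion) => //.
  by exists 1; [apply: lreg1 | rewrite scaler0].
move=> a u w [s rs su] [t rt tw]; exists (s * t); first exact: lregM.
rewrite scalerDr -[_ *: w]scalerA tw scaler0 addr0 scalerA -mulrA mulrC.
by rewrite -scalerA su scaler0.
Qed.

Definition mod_torsion : lmodType S := mquot torsion.

End Torsion.

(* The natural map E -> nu_*(nu^*E / Torsion) is bijective, where phi is the
   ring map of the modification nu. *)
Section Saturation.
Variables (S S' : comPzRingType) (phi : {rmorphism S -> S'}) (E : lmodType S).

Definition pull_mod_torsion : lmodType S' := mod_torsion (tensor phi E).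

Definition natural_map (e : E) : restr phi pull_mod_torsion :=
  mclass (@torsion S' (tensor phi E)) (tens phi e 1).

Lemma natural_map_linear : linear natural_map.
Proof.
move=> a x y; rewrite /natural_map tensDl raddfD tensZl mulr1.
congr (_ + _); rewrite -[RHS]/(phi a *: mclass _ _) -linearZ /=.
by rewrite -[phi a *: tens _ _ _]/(tens_scale _ _) tens_scale_tens mulr1.
Qed.

Definition saturated : Prop := bijective natural_map.

End Saturation.

(* The submodule of (O/f)^d generated by the columns of the adjugate of M. *)
Section KernelModule.
Variables (O : comUnitRingType) (f : O) (d : nat) (M : 'M[O]_d).

Definition adj_mod : 'M[rquot f]_d := map_mx (rclass f) (\adj M).

Definition in_kernel : {pred 'cV[rquot f]_d} :=
  fun w => `[< exists c : 'cV[rquot f]_d, w = adj_mod *m c >].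

Fact in_kernel_submod : submod_closed in_kernel.
Proof.
split=> [|a u w /asboolP[c ->] /asboolP[e ->]]; apply/asboolP.
  by exists 0; rewrite mulmx0.
by exists (a *: c + e); rewrite mulmxDr scalemxAr.
Qed.

HB.instance Definition _ := GRing.isSubmodClosed.Build (rquot f)
  'cV[rquot f]_d in_kernel in_kernel_submod.

Record kernel_module := KernelModule {
  kernel_val :> 'cV[rquot f]_d; _ : kernel_val \in in_kernel }.

HB.instance Definition _ := [isSub for kernel_val].
HB.instance Definition _ := [Choice of kernel_module by <:].
HB.instance Definition _ := [SubChoice_isSubLmodule of kernel_module by <:].

End KernelModule.

(* X_1 = {f1 = 0}, X_2 = {f2 = 0}, X = {f1 f2 = 0}, X' = X_1 \coprod X_2. *)
Section Separation.
Variables (O : comUnitRingType) (f1 f2 : O).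

Fact dvd_left : exists c, f1 * f2 = c * f1.
Proof. by exists f2; rewrite mulrC. Qed.
Fact dvd_right : exists c, f1 * f2 = c * f2.
Proof. by exists f1. Qed.

Definition res1 : {rmorphism rquot (f1 * f2) -> rquot f1} := rres dvd_left.
Definition res2 : {rmorphism rquot (f1 * f2) -> rquot f2} := rres dvd_right.

Definition nu_fun (x : rquot (f1 * f2)) : (rquot f1 * rquot f2)%type :=
  (res1 x, res2 x).

Fact nu_funB : zmod_morphism nu_fun.
Proof. by move=> x y; rewrite /nu_fun !raddfB. Qed.
Fact nu_funM : monoid_morphism nu_fun.
Proof. by split=> [|x y]; rewrite /nu_fun ?rmorph1 ?rmorphM. Qed.
HB.instance Definition _ := GRing.isZmodMorphism.Build
  (rquot (f1 * f2)) (rquot f1 * rquot f2)%type nu_fun nu_funB.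
HB.instance Definition _ := GRing.isMonoidMorphism.Build
  (rquot (f1 * f2)) (rquot f1 * rquot f2)%type nu_fun nu_funM.

Definition nu : {rmorphism rquot (f1 * f2) -> (rquot f1 * rquot f2)%type} :=
  nu_fun.

(* Adj_{X'/X} *)
Definition rel_adjoint (g : O) : Prop :=
  forall s : (rquot f1 * rquot f2)%type,
    exists r : rquot (f1 * f2), nu (rclass (f1 * f2) g) * s = nu r.

Definition mx_saturated d (M : 'M[O]_d) : Prop :=
  forall i j, rel_adjoint ((\adj M) i j).

Definition ideal_gen2 (g : O) : Prop := exists a b, g = a * f1 + b * f2.

(* E|_{X_i} / Torsion as an O_X-module *)
Definition comp1 (E : lmodType (rquot (f1 * f2))) :
  lmodType (rquot (f1 * f2)) := restr res1 (mod_torsion (tensor res1 E)).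
Definition comp2 (E : lmodType (rquot (f1 * f2))) :
  lmodType (rquot (f1 * f2)) := restr res2 (mod_torsion (tensor res2 E)).

(* E_1 and E_2 are quotients of E rather than submodules, so E = E_1 (+) E_2 is
   read as an isomorphism of O_X-modules. *)
Definition splits (E : lmodType (rquot (f1 * f2))) : Prop :=
  exists h : {linear E -> (comp1 E * comp2 E)%type}, bijective h.

Definition no_common_component : Prop :=
  forall g : O, (exists a, f1 = a * g) -> (exists b, f2 = b * g) ->
    g \is a GRing.unit.

End Separation.

Definition loc_equiv (O : comUnitRingType) d (M N : 'M[O]_d) : Prop :=
  exists A B : 'M[O]_d,
    [/\ A \in unitmx, B \in unitmx & N = A *m M *m B].

Section Germs.
Variables (R : realType) (k : fieldType) (v : complete_norm R k).
Variables (kd : series_kind) (n : nat).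
Notation O := (germ_ring v kd n).

Definition hypersurface_germ (f : O) : Prop := f != 0 /\ at_origin f = 0.

Definition det_rep (f : O) d (M : 'M[O]_d) : Prop :=
  (forall i j, at_origin (M i j) = 0) /\
  exists2 u : O, u \is a GRing.unit & \det M = u * f.

Definition mx_splits (f1 f2 : O) d (M : 'M[O]_d) : Prop :=
  exists d1 d2 (e : (d1 + d2)%N = d) (M1 : 'M[O]_d1) (M2 : 'M[O]_d2),
    [/\ det_rep f1 M1, det_rep f2 M2
      & loc_equiv M (castmx (e, e) (block_mx M1 0 0 M2))].

End Germs.

(* Main.v *)
(* Put N = adj M, so M N = N M = u f1 f2 with u a unit.  The only property of O
   needed beyond being a local domain is that, f1 and f2 having no common factor,
   f1 | f2 h implies f1 | h.  This is proved by induction on the number of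
   variables: after a shear f becomes a unit times a Weierstrass polynomial over
   the ring in one variable less, where Gauss's lemma applies.

   All conditions are compared with (1').  If N = f1 A + f2 B, then M B = f1 B' and
   M A = f2 A' with A' + B' = u, and P = B'/u satisfies N P = f2 B and
   N (1 - P) = f1 A.  Hence every e = N c in E is the sum of N P c, killed by f1,
   and N (1 - P) c, killed by f2; such a decomposition of E is equivalent to (1')
   and, torsion in E|_{X_i} being the kernel of restriction to (O/f_i)^d, to (1)
   and to (2).  Moreover P (1 - P) lies in the image of M, so P is idempotent at
   the origin; a base change adapted to P makes N a combination
   f2 B1 + f1 A2 with complementary column supports, and B1 M / (u f1) is then an
   idempotent over O intertwined by M with a diagonal projector, which splits M
   into blocks.  Comparing determinants gives (2'). *)

Require Import Defs.
From mathcomp Require Import freeg.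
From mathcomp Require Import all_boot all_order all_algebra reals.
From HB Require Import structures.
From mathcomp Require Import boolp mpoly ring lra zify.

Set Implicit Arguments.
Unset Strict Implicit.
Unset Printing Implicit Defensive.

Import Order.TTheory GRing.Theory Num.Theory.
Local Open Scope ring_scope.

(** * Power series *)

(** Irreducible factorisations are never chosen: cancellation itself turns irreducible elements into
    primes, and descent on the order of vanishing, which is additive and zero only at units, finds
    the prime divisors that Gauss's lemma asks for. The shear is explicit, with weights under which
    one monomial of the series is strictly lightest, so no generic coordinates have to be selected
    and the inverse is the shear with the opposite sign. In the splitting of M, P (1 - P) is only
    known to vanish at the origin; lifting P to an idempotent is avoided because divisibility by f1
    and f2 yields a second, exact idempotent. It and P give diagonal projectors of a priori
    different ranks, which are compared through traces, and here characteristic zero enters. On the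
    module side the conditions f_i e = 0 serve because every O_X-linear isomorphism preserves them,
    whereas restriction to X_i is tied to the embedding in (O/f)^d. *)

Section SeriesRing.
Variables (A : comNzRingType) (n : nat).
Implicit Types (f g h : fps n A) (a b m : 'X_{1..n}).

Lemma fps_coefM_single f g a b :
  (forall c d, (c + d = a + b)%MM -> c != a -> fcoef f c * fcoef g d = 0) ->
  fcoef (f * g) (a + b)%MM = fcoef f a * fcoef g b.
Proof.
move=> fg0; pose N := (mdeg (a + b)).+1.
have la : (mdeg a < N)%N by rewrite ltnS mdegD leq_addr.
have lb : (mdeg b < N)%N by rewrite ltnS mdegD leq_addl.
rewrite fps_coefM (bigD1 (BMultinom la, BMultinom lb)) ?eqxx //=.
rewrite big1 ?addr0 // => -[c d] /= /andP[/eqP cd ne]; apply: fg0 => //.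
apply: contra ne => /eqP ca; rewrite xpair_eqE -!val_eqE /= ca eqxx /=.
by move: cd; rewrite ca => /addmI ->.
Qed.

Lemma fps_coefM_eq0 f g m :
  (forall a b, (a + b = m)%MM -> fcoef f a * fcoef g b = 0) ->
  fcoef (f * g) m = 0.
Proof.
move=> fg0; rewrite fps_coefM big1 // => -[c d] /= /eqP cd; exact: fg0.
Qed.

Lemma fps_coefD f g m : fcoef (f + g) m = fcoef f m + fcoef g m. Proof. by []. Qed.

Definition fps_poly (p : {mpoly A[n]}) : fps n A := Fps (fun m => p@_m).

Lemma fps_poly_agree N p : fps_agree N (fps_poly p) p.
Proof. by []. Qed.

Lemma fps_coef_poly p m : fcoef (fps_poly p) m = p@_m. Proof. by []. Qed.

Fact fps_poly_zmod : zmod_morphism fps_poly.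
Proof. by move=> p q; apply: fpsP => m /=; rewrite mcoeffB. Qed.
Fact fps_poly_monoid : monoid_morphism fps_poly.
Proof.
split=> [|p q]; apply: fpsP => m; first by rewrite /= mcoeff1.
by rewrite -(fps_agreeM (@fps_poly_agree (mdeg m).+1 p) (fps_poly_agree q)).
Qed.
HB.instance Definition _ :=
  GRing.isZmodMorphism.Build {mpoly A[n]} (fps n A) fps_poly fps_poly_zmod.
HB.instance Definition _ :=
  GRing.isMonoidMorphism.Build {mpoly A[n]} (fps n A) fps_poly fps_poly_monoid.

Lemma fps_coefXM a f m :
  fcoef (fps_poly 'X_[a] * f) (a + m)%MM = fcoef f m.
Proof.
rewrite fps_coefM_single /= ?mcoeffX ?eqxx ?mul1r // => c d _.
by rewrite mcoeffX eq_sym => /negPf->; rewrite mul0r.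
Qed.

Lemma fps_coefXM_eq0 a f m :
  ~~ (a <= m)%MM -> fcoef (fps_poly 'X_[a] * f) m = 0.
Proof.
move=> nam; apply: fps_coefM_eq0 => c d cd; rewrite /= mcoeffX.
case: eqP => [ac|_]; last by rewrite mul0r.
by move: nam; rewrite ac -cd lem_addr.
Qed.

Lemma fps_neq0_lowest f : f != 0 ->
  exists2 m, fcoef f m != 0 & forall a, fcoef f a != 0 -> (m <= a)%O.
Proof.
move=> f0; have [m fm] : exists m, fcoef f m != 0.
  apply: contrapT => no; case/eqP: f0; apply: fpsP => m.
  by apply/eqP/negP => /negP fm; apply: no; exists m.
elim/(@ltmwf n): m fm => m IH fm.
have [[a /andP[fa am]]|no] := pselect (exists a, (fcoef f a != 0) && (a < m)%O).
  exact: IH am fa.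
exists m => // a fa; rewrite leNgt; apply/negP => am; apply: no.
by exists a; rewrite fa.
Qed.

End SeriesRing.

Section SeriesDomain.
Variables (k : fieldType) (n : nat).
Implicit Types (f g h : fps n k) (a b m : 'X_{1..n}).

Definition lowest_monomial f m := fcoef f m != 0 /\ forall a, fcoef f a != 0 -> (m <= a)%O.

(** The monomial order is total and compatible with addition, so the sum of the two lowest exponents
    arises from one pair only. *)
Lemma lowestM f g a b :
  lowest_monomial f a -> lowest_monomial g b -> lowest_monomial (f * g) (a + b)%MM.
Proof.
move=> [fa fle] [gb gle]; split.
  rewrite fps_coefM_single ?mulf_neq0 // => c d cd ca.
  apply/eqP; rewrite mulf_eq0; apply/norP => -[/fle ac /gle bd].
  have lt_ac : (a < c)%O by rewrite lt_neqAle eq_sym ca.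
  by have := ltmc_le_add lt_ac bd; rewrite cd ltxx.
move=> m; apply: contraR; rewrite -ltNge => lt_m; apply/eqP/fps_coefM_eq0.
move=> c d cd; apply/eqP; rewrite mulf_eq0; apply/norP => -[/fle ac /gle bd].
by have := lem_add ac bd; rewrite cd leNgt lt_m.
Qed.

Lemma fps_mulf_eq0 f g : f * g = 0 -> f = 0 \/ g = 0.
Proof.
move=> fg; have [->|f0] := eqVneq f 0; first by left.
have [->|g0] := eqVneq g 0; first by right.
have [a fa ale] := fps_neq0_lowest f0; have [b gb ble] := fps_neq0_lowest g0.
by have [] := lowestM (conj fa ale) (conj gb ble); rewrite fg eqxx.
Qed.

End SeriesDomain.

(** * Weighted l1 norms and convergence *)

Section WeightedBounds.
Variables (R : realType) (k : fieldType) (v : complete_norm R k) (n : nat).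
Implicit Types (f g h : fps n k) (a b m : 'X_{1..n}) (w : 'X_{1..n} -> R).

(** A bound for the weighted l1 norm. Quantifying over duplicate-free lists instead of degree
    truncations allows reindexing along any injective map of exponents. *)
Definition weight_bounded w C f := forall s : seq 'X_{1..n}, uniq s ->
  \sum_(m <- s) v (fcoef f m) * w m <= C.

Lemma sum_bmultinom (S : nmodType) (F : 'X_{1..n} -> S) s N :
  uniq s -> (forall m, m \in s -> (mdeg m < N)%N) ->
  \sum_(m <- s) F m = \sum_(m : 'X_{1..n < N} | bmnm m \in s) F m.
Proof.
move=> us sN; rewrite -(big_map (@bmnm n N) (mem s) F) -big_filter.
apply/perm_big/uniq_perm => //.
  by rewrite filter_uniq // map_inj_uniq ?index_enum_uniq //; apply: val_inj.
move=> m; rewrite mem_filter inE /=.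
case ms: (m \in s) => //=; apply/esym/mapP.
by exists (BMultinom (sN m ms)) => //; rewrite mem_index_enum.
Qed.

Lemma seq_mdeg_bound (s : seq 'X_{1..n}) :
  exists N, forall m, m \in s -> (mdeg m < N)%N.
Proof.
exists (\max_(m <- s) mdeg m).+1 => m ms; rewrite ltnS.
exact: (@leq_bigmax_seq _ s predT (@mdeg n)).
Qed.

Lemma bounded_ge0 w C f : weight_bounded w C f -> 0 <= C.
Proof. by move=> /(_ [::] isT); rewrite big_nil. Qed.

Lemma boundedW w w' C f : (forall m, w' m <= w m) ->
  weight_bounded w C f -> weight_bounded w' C f.
Proof.
move=> ww fC s us; apply: le_trans (fC s us); apply: ler_sum => m _.
by rewrite ler_wpM2l ?nrm_ge0.
Qed.

Lemma bounded_leC w C D f : C <= D -> weight_bounded w C f -> weight_bounded w D f.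
Proof. by move=> CD fC s us; apply: le_trans (fC s us) CD. Qed.

Section Weight.
Variable w : 'X_{1..n} -> R.
Hypotheses (w_ge0 : forall m, 0 <= w m).
Hypothesis (wD : forall a b, w (a + b)%MM = w a * w b).

(** Submultiplicativity for a multiplicative weight: a product of two finite sums, regrouped by
    total exponent, dominates the Cauchy product. *)
Lemma boundedM f g C D :
  weight_bounded w C f -> weight_bounded w D g -> weight_bounded w (C * D) (f * g).
Proof.
move=> fC gD s us; have [N sN] := seq_mdeg_bound s.
have [uN wN] : uniq (map (@bmnm n N) (index_enum _))
    /\ forall F, \sum_(m <- map (@bmnm n N) (index_enum _)) F m
       = \sum_(m : 'X_{1..n < N}) F (bmnm m) :> R.
  by split=> [|F]; rewrite ?big_map // map_inj_uniq ?index_enum_uniq //; apply: val_inj.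
have ge0 h (m : 'X_{1..n}) : 0 <= v (fcoef h m) * w m.
  by rewrite mulr_ge0 ?nrm_ge0.
have fCN := fC _ uN; have gDN := gD _ uN; rewrite !wN in fCN gDN.
apply: le_trans (ler_pM _ _ fCN gDN); try by apply: sumr_ge0.
pose F (l : 'X_{1..n < N, N}) :=
  (v (fcoef f l.1) * w l.1) * (v (fcoef g l.2) * w l.2).
have F_ge0 l : 0 <= F l by rewrite mulr_ge0 ?ge0.
rewrite mulr_suml (eq_bigr (fun a : 'X_{1..n < N} =>
  \sum_(b : 'X_{1..n < N}) F (a, b))) => [|a _]; last by rewrite mulr_sumr.
rewrite pair_bigA (sum_bmultinom _ us sN).
apply: (@le_trans _ _ (\sum_(m : 'X_{1..n < N} | bmnm m \in s)
    \sum_(l : 'X_{1..n < N, N} | bmnm m == (l.1 + l.2)%MM) F l)).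
  apply: ler_sum => m _; rewrite (@fps_coefMw _ _ N f g m (bmdeg m)).
  apply: le_trans (ler_wpM2r _ (nrm_sum v _ _)) _; first exact: w_ge0.
  rewrite mulr_suml; apply: ler_sum => l /eqP ->.
  by rewrite nrmM wD mulrACA.
rewrite (exchange_big_dep predT) //=; apply: ler_sum => -[a b] _.
rewrite sumr_const -[leRHS]mulr1n ler_wpMn2l //.
apply/card_le1_eqP => m m'; rewrite !unfold_in => /andP[_ /eqP mE] /andP[_ /eqP m'E].
by apply: val_inj; rewrite /= mE m'E.
Qed.

Lemma boundedB f g C D :
  weight_bounded w C f -> weight_bounded w D g -> weight_bounded w (C + D) (f - g).
Proof.
move=> fC gD s us; apply: le_trans (lerD (fC s us) (gD s us)).
rewrite -big_split /=; apply: ler_sum => m _.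
by rewrite -mulrDl ler_wpM2r // -(nrmN v (fcoef g m)); apply: nrmD.
Qed.

End Weight.

Lemma convergent_weight_boundedP f :
  convergent v f <-> exists2 r : R, 0 < r & exists C, weight_bounded (fun m => r ^+ mdeg m) C f.
Proof.
split=> -[r r0 [C fC]]; exists r => //; exists C; [move=> s us|move=> N].
  have [N sN] := seq_mdeg_bound s; apply: le_trans (fC N).
  rewrite (sum_bmultinom _ us sN) [leRHS](bigID (fun m : 'X_{1..n < N} => bmnm m \in s)) /=.
  rewrite lerDl sumr_ge0 // => m _.
  by rewrite mulr_ge0 ?nrm_ge0 // exprn_ge0 // ltW.
rewrite -(big_map (@bmnm n N) predT (fun m => v (fcoef f m) * r ^+ mdeg m)).
apply: fC; rewrite map_inj_uniq ?index_enum_uniq //; exact: val_inj.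
Qed.

End WeightedBounds.

(** * Division by a series with an isolated initial monomial *)

Section Division.
Variables (k : fieldType) (n : nat).
Implicit Types (f g h x y : fps n k) (a b m : 'X_{1..n}).
Variables (L : 'X_{1..n} -> nat) (alpha : 'X_{1..n}) (f : fps n k).
Hypotheses (LD : forall a b, L (a + b)%MM = (L a + L b)%N).

Definition initial_at :=
  fcoef f alpha != 0 /\
  forall m, fcoef f m != 0 -> m != alpha -> (L alpha < L m)%N.

Hypothesis f_alpha : initial_at.

(** The hypothesis says that no monomial of [q * f] is a multiple of the initial one. A term of [q]
    of least weight, times the initial term of [f], could not be cancelled. *)
Lemma division_unique q : (forall m, fcoef (q * f) (m + alpha)%MM = 0) -> q = 0.
Proof.
move=> qf0; suff q0 j m : (L m < j)%N -> fcoef q m = 0.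
  by apply: fpsP => m; apply: (q0 (L m).+1).
elim: j m => // j IH m; rewrite ltnS => Lm.
have [f0 f_gt] := f_alpha.
apply/eqP/(contraT (b := _)) => qm; have := qf0 m.
rewrite fps_coefM_single => [/eqP|c d cd cm].
  by rewrite mulf_eq0 (negPf qm) (negPf f0).
apply/eqP; rewrite mulf_eq0; apply/norP => -[qc fd].
have da : d != alpha.
  by apply: contraNneq cm => da; move: cd; rewrite da => /addIm ->.
have := f_gt _ fd da; have /(congr1 L) := cd; rewrite !LD => cdL lt_d.
by rewrite IH ?eqxx // in qc; lia.
Qed.

Definition nonleading := f - fps_poly (fcoef f alpha *: 'X_[alpha]).

Lemma fcoef_nonleading m : fcoef nonleading m = if m == alpha then 0 else fcoef f m.
Proof.
rewrite fps_coefB /= mcoeffZ mcoeffX eq_sym.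
by case: eqVneq => [->|_]; rewrite ?mulr1 ?subrr // mulr0 subr0.
Qed.

Lemma nonleading_gt m : fcoef nonleading m != 0 -> (L alpha < L m)%N.
Proof.
rewrite fcoef_nonleading; case: (eqVneq m alpha) => [_|ma fm]; first by rewrite eqxx.
by have [_ f_gt] := f_alpha; apply: f_gt.
Qed.

(** The part of [x] divisible by the initial monomial, divided by the initial term of [f]. Writing
    [f] as that term plus [nonleading], the quotient of [h] is the solution q of q =
    [division_shift h] - [division_step q]. *)
Definition division_shift x : fps n k :=
  Fps (fun m => (fcoef f alpha)^-1 * fcoef x (alpha + m)%MM).

Lemma fcoef_division_shift x m :
  fcoef (division_shift x) m = (fcoef f alpha)^-1 * fcoef x (alpha + m)%MM.
Proof. by []. Qed.

Definition division_step x := division_shift (x * nonleading).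

Lemma division_stepB x y : division_step x - division_step y = division_step (x - y).
Proof.
by apply: fpsP => m; rewrite fps_coefB !fcoef_division_shift -mulrBr mulrBl fps_coefB.
Qed.

Definition agree_below j x y := forall m, (L m < j)%N -> fcoef x m = fcoef y m.

(** Multiplying by [nonleading] adds at least [L alpha + 1] to the weight and the shift takes
    [L alpha] away. *)
Lemma division_step_agree j x y :
  agree_below j x y -> agree_below j.+1 (division_step x) (division_step y).
Proof.
move=> xy m; rewrite ltnS => Lm; apply/eqP; rewrite -subr_eq0 -fps_coefB division_stepB.
apply/eqP; rewrite fcoef_division_shift fps_coefM_eq0 ?mulr0 // => a b ab.
have [La|La] := ltnP (L a) j; first by rewrite fps_coefB xy // subrr mul0r.
have [->|/nonleading_gt Lb] := eqVneq (fcoef nonleading b) 0; first by rewrite mulr0.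
by have /(congr1 L) := ab; rewrite !LD; lia.
Qed.

Variable h : fps n k.

Definition quo_iter j := iter j (fun x => division_shift h - division_step x) 0.

Lemma quo_iter_agree j : agree_below j (quo_iter j) (quo_iter j.+1).
Proof.
elim: j => [|j IH] m Lm //; rewrite /quo_iter iterS [in RHS]iterS.
by rewrite !fps_coefB (division_step_agree IH).
Qed.

Lemma quo_iter_agree_le i j : (i <= j)%N -> agree_below i (quo_iter i) (quo_iter j).
Proof.
elim: j => [|j IH]; first by rewrite leqn0 => /eqP->.
rewrite leq_eqVlt ltnS => /orP[/eqP->//|ij] m Lm.
by rewrite (IH ij m Lm) (@quo_iter_agree j) //; apply: leq_trans Lm ij.
Qed.

(* The iteration raises the L-order of the error by one at each step, so the
   coefficient at m is final after (L m).+1 steps. *)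
Definition division_quo := Fps (fun m => fcoef (quo_iter (L m).+1) m).

Lemma quo_agree j : agree_below j division_quo (quo_iter j).
Proof. by move=> m Lm; exact: (quo_iter_agree_le Lm). Qed.

Lemma quo_fix : division_quo = division_shift h - division_step division_quo.
Proof.
by apply: fpsP => m; rewrite fps_coefB (division_step_agree (@quo_agree (L m))).
Qed.

Lemma quo_rem m : fcoef (h - division_quo * f) (alpha + m)%MM = 0.
Proof.
have fE : f = fps_poly (fcoef f alpha *: 'X_[alpha]) + nonleading by rewrite addrC subrK.
rewrite [X in _ * X]fE mulrDr fps_coefB fps_coefD.
have -> : fcoef (division_quo * fps_poly (fcoef f alpha *: 'X_[alpha])) (alpha + m)%MM
          = fcoef f alpha * fcoef division_quo m.
  rewrite mulrC fps_coefM_single ?fps_coef_poly ?mcoeffZ ?mcoeffX ?eqxx ?mulr1 // => c d _.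
  by rewrite fps_coef_poly mcoeffZ mcoeffX eq_sym => /negPf->; rewrite mulr0 mul0r.
have [f0 _] := f_alpha.
by rewrite {1}quo_fix fps_coefB !fcoef_division_shift mulrBr !mulVKf // subrK subrr.
Qed.

End Division.

(** * Weierstrass division for convergent series *)

Section ConvergentDivision.
Variables (R : realType) (k : fieldType) (v : complete_norm R k) (n : nat).
Variables (L : 'X_{1..n} -> nat) (alpha : 'X_{1..n}) (f h : fps n k).
Hypotheses (LD : forall a b, L (a + b)%MM = (L a + L b)%N).
Variable B : nat.
Hypothesis L_mdeg : forall m, (mdeg m <= L m <= B * mdeg m)%N.
Hypothesis f_alpha : initial_at L alpha f.

Lemma nrm_gt0 (x : k) : x != 0 -> 0 < v x.
Proof.
by move=> x0; rewrite lt_def nrm_ge0 andbT; apply/eqP => /nrm_eq0/eqP; apply/negP.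
Qed.

Lemma nrmV (x : k) : x != 0 -> v x^-1 = (v x)^-1.
Proof.
move=> x0; apply: (mulfI (lt0r_neq0 (nrm_gt0 x0))).
by rewrite -nrmM !divff ?nrm1 ?lt0r_neq0 ?nrm_gt0.
Qed.

Lemma bounded_division_shift (w : 'X_{1..n} -> R) C x :
  (forall a b, w (a + b)%MM = w a * w b) -> 0 < w alpha ->
  weight_bounded v w C x ->
  weight_bounded v w ((v (fcoef f alpha) * w alpha)^-1 * C) (division_shift alpha f x).
Proof.
move=> wD wa xC s us; have f0 := f_alpha.1.
have ua : uniq (map (mnm_add alpha) s) by rewrite map_inj_uniq //; apply: addmI.
have := xC _ ua; rewrite big_map => xs.
rewrite ler_pdivlMl ?mulr_gt0 ?nrm_gt0 //; apply: le_trans xs; rewrite mulr_sumr.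
apply: ler_sum => m _; rewrite /= nrmM nrmV // wD.
rewrite [leLHS](_ : _ = v (fcoef f alpha) * (v (fcoef f alpha))^-1 *
  (v (fcoef x (alpha + m)%MM) * (w alpha * w m))); last by ring.
by rewrite divff ?mul1r // lt0r_neq0 ?nrm_gt0.
Qed.

(** All iterates obey one bound in a suitable weighted norm and their coefficients stabilise, so the
    quotient inherits the bound. The two-sided comparison of [L] with the degree carries convergence
    to this weight and back. *)
Lemma convergent_quo : convergent v f -> convergent v h -> convergent v (division_quo L alpha f h).
Proof.
move=> /convergent_weight_boundedP[r r0 [C fC]] /convergent_weight_boundedP[r' r'0 [D hD]].
pose e := Num.min (Num.min r r') 1.
have e0 : 0 < e by rewrite !lt_min r0 r'0 ltr01.
have e1 : e <= 1 by rewrite ge_min lexx orbT.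
have er : e <= r by rewrite !ge_min lexx.
have er' : e <= r' by rewrite !ge_min lexx orbT.
have eL (t : R) m : 0 < t -> e <= t -> e ^+ L m <= t ^+ mdeg m.
  have /andP[dL _] := L_mdeg m.
  move=> t0 et; apply: (@le_trans _ _ (e ^+ mdeg m)).
    by rewrite ler_wiXn2l // ltW.
  by rewrite lerXn2r // nnegrE ltW.
have {}fC : weight_bounded v (fun m => e ^+ L m) C f by apply: boundedW fC => m; exact: eL.
have {}hD : weight_bounded v (fun m => e ^+ L m) D h by apply: boundedW hD => m; exact: eL.
have C0 := bounded_ge0 fC; have D0 := bounded_ge0 hD.
have [f0 f_gt] := f_alpha; have vf0 := nrm_gt0 f0.
(* [K] bounds the norm of [f] relative to its initial term; [d] is then chosen with d <= 1 and K d
   <= 1/2. *)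
pose K := (v (fcoef f alpha) * e ^+ L alpha)^-1 * C.
have K0 : 0 <= K by rewrite mulr_ge0 // invr_ge0 mulr_ge0 ?exprn_ge0 ?ltW.
pose d := (2 * (K + 1))^-1.
have d0 : 0 < d by rewrite invr_gt0 mulr_gt0 // ltr_wpDl.
have d1 : d <= 1 by rewrite invf_le1 ?mulr_gt0 ?ltr_wpDl //; lra.
have Kd : K * d <= 2^-1.
  by rewrite /d invfM mulrCA ler_piMr ?invr_ge0 // ler_pdivrMr ?mul1r ?ltr_wpDl //; lra.
(* Non-leading monomials of f have L-degree at least L alpha + 1, so the extra
   factor d in the weight turns the division step into a 1/2-contraction. *)
pose w m := (e * d) ^+ L m.
have wD a b : w (a + b)%MM = w a * w b by rewrite /w LD exprD.
have w0 m : 0 < w m by rewrite exprn_gt0 // mulr_gt0.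
have w_ge0 m : 0 <= w m by apply: ltW.
have we m : w m <= e ^+ L m.
  by rewrite /w exprMn ler_piMr ?exprn_ge0 ?exprn_ile1 // ltW.
have nonleadingC : weight_bounded v w (d ^+ (L alpha).+1 * C) (nonleading alpha f).
  move=> s us; apply: le_trans (ler_wpM2l _ (fC _ us)); last by rewrite exprn_ge0 ?ltW.
  rewrite mulr_sumr; apply: ler_sum => m _.
  have [->|tm] := eqVneq (fcoef (nonleading alpha f) m) 0.
    rewrite nrm0 mul0r mulr_ge0 ?exprn_ge0 ?(ltW d0) //.
    by rewrite mulr_ge0 ?nrm_ge0 ?exprn_ge0 ?(ltW e0).
  have lt_m := nonleading_gt f_alpha tm.
  have -> : fcoef (nonleading alpha f) m = fcoef f m.
    by move: tm; rewrite fcoef_nonleading; case: (m == alpha); rewrite ?eqxx.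
  rewrite /w exprMn [leRHS]mulrCA ler_wpM2l ?nrm_ge0 // [leLHS]mulrC.
  by rewrite ler_wpM2r ?exprn_ge0 ?(ltW e0) // ler_wiXn2l // ltW.
have stepC x X : weight_bounded v w X x -> weight_bounded v w (2^-1 * X) (division_step alpha f x).
  move=> xX; have X0 := bounded_ge0 xX.
  have := bounded_division_shift wD (w0 alpha) (boundedM w_ge0 wD xX nonleadingC).
  apply: bounded_leC; apply: le_trans (ler_wpM2r X0 Kd); rewrite le_eqVlt.
  apply/orP; left; apply/eqP; rewrite /K /w exprMn exprS.
  by field; rewrite !expf_neq0 ?lt0r_neq0.
pose H := (v (fcoef f alpha) * w alpha)^-1 * D.
have hH : weight_bounded v w H (division_shift alpha f h).
  by apply: bounded_division_shift => //; apply: boundedW hD.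
(* 2 H is the fixed point of X = H + X / 2. *)
have iterC j : weight_bounded v w (2 * H) (quo_iter alpha f h j).
  elim: j => [|j IH].
    move=> s us; rewrite big1 => [|m _]; last by rewrite nrm0 mul0r.
    by rewrite mulr_ge0 // (bounded_ge0 hH).
  rewrite /quo_iter iterS; have := boundedB w_ge0 hH (stepC _ _ IH).
  by apply: bounded_leC; lra.
have quoC : weight_bounded v w (2 * H) (division_quo L alpha f h).
  move=> s us; have [N sN] : exists N, forall m, m \in s -> (L m < N)%N.
    exists (\max_(m <- s) L m).+1 => m ms; rewrite ltnS.
    exact: (@leq_bigmax_seq _ s predT L).
  apply: le_trans (iterC N _ us); rewrite big_seq [leRHS]big_seq.
  by apply: ler_sum => m ms; rewrite (@quo_agree _ _ _ _ _ LD f_alpha h N) ?sN.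
(* Since e d <= 1 and L m <= B |m|, the radius (e d)^B gives a weight below [w]. *)
apply/convergent_weight_boundedP; exists ((e * d) ^+ B).
  by rewrite exprn_gt0 ?mulr_gt0.
exists (2 * H); apply: boundedW quoC => m; rewrite -exprM.
have /andP[_ LB] := L_mdeg m.
by apply: ler_wiXn2l => //; rewrite ?mulr_ge0 ?mulr_ile1 // ltW.
Qed.

End ConvergentDivision.

(** * Germs inside formal series: division and units *)

Section GermRing.
Variables (R : realType) (k : fieldType) (v : complete_norm R k).
Variable kd : series_kind.

Definition germ_convergent n (f : fps n k) :=
  if kd is Convergent then convergent v f else True.

Section Series.
Variable n : nat.
Notation O := (germ_ring v kd n).
Notation series := (@germ_series R k v kd n).

Fact germ_series_zmod : zmod_morphism series.
Proof. by case: kd => x y. Qed.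
Fact germ_series_monoid : monoid_morphism series.
Proof. by case: kd. Qed.
HB.instance Definition _ := GRing.isZmodMorphism.Build O (fps n k) series germ_series_zmod.
HB.instance Definition _ := GRing.isMonoidMorphism.Build O (fps n k) series germ_series_monoid.

Lemma germ_series0 : series 0 = 0. Proof. exact: rmorph0. Qed.
Lemma germ_series1 : series 1 = 1. Proof. exact: rmorph1. Qed.
Lemma germ_seriesD f g : series (f + g) = series f + series g. Proof. exact: rmorphD. Qed.
Lemma germ_seriesB f g : series (f - g) = series f - series g. Proof. exact: rmorphB. Qed.
Lemma germ_seriesM f g : series (f * g) = series f * series g. Proof. exact: rmorphM. Qed.
Lemma germ_series_sum (I : finType) (P : pred I) (F : I -> O) :
  series (\sum_(i | P i) F i) = \sum_(i | P i) series (F i).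
Proof. exact: rmorph_sum. Qed.

Lemma germ_series_inj : injective series.
Proof. by case: kd => //= x y /val_inj. Qed.

Lemma germ_series_convergent (f : O) : germ_convergent (series f).
Proof. by move: f; rewrite /germ_convergent; case: kd => //= -[f /= /asboolP]. Qed.

Lemma germ_series_surj (f : fps n k) : germ_convergent f -> exists g : O, series g = f.
Proof.
rewrite /germ_convergent; case: kd => /= [/asboolP cf|_]; last by exists f.
by exists (Cps (cf : f \in @convergentb R k v n)).
Qed.

(** A total inverse of [germ_series], with the default value 0 outside its image. *)
Definition germ_of (f : fps n k) : O :=
  if pselect (exists g : O, series g = f) is left e then sval (cid e) else 0.

Lemma germ_ofK f : germ_convergent f -> series (germ_of f) = f.
Proof.
by move=> /germ_series_surj cf; rewrite /germ_of; case: pselect => // e; case: cid.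
Qed.

Lemma germ_mulf_eq0 (f g : O) : f * g = 0 -> f = 0 \/ g = 0.
Proof.
move=> /(congr1 series); rewrite germ_seriesM germ_series0 => /fps_mulf_eq0.
by case=> fg0; [left|right]; apply: germ_series_inj; rewrite fg0 germ_series0.
Qed.

Lemma germ_division (L : 'X_{1..n} -> nat) alpha B (f h : O) :
  (forall a b, L (a + b)%MM = (L a + L b)%N) ->
  (forall m, mdeg m <= L m <= B * mdeg m)%N ->
  initial_at L alpha (series f) ->
  exists q : O, forall m, fcoef (series (h - q * f)) (alpha + m)%MM = 0.
Proof.
move=> LD LB f_alpha.
have cq : germ_convergent (division_quo L alpha (series f) (series h)).
  have := germ_series_convergent f; have := germ_series_convergent h.
  rewrite /germ_convergent; case: kd f h f_alpha => //= f h f_alpha ch cf.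
  exact: (convergent_quo LD LB).
exists (germ_of (division_quo L alpha (series f) (series h))) => m.
by rewrite germ_seriesB germ_seriesM germ_ofK // quo_rem.
Qed.

(** Divide 1 by [f] with initial monomial 1: every monomial is a multiple of it, so the remainder
    vanishes and the quotient is the inverse. *)
Lemma germ_unitE (f : O) : (f \is a GRing.unit) = (at_origin f != 0).
Proof.
have mulE (g h : O) : at_origin (g * h) = at_origin g * at_origin h.
  rewrite /at_origin germ_seriesM -{1}[0%MM]addm0 fps_coefM_single // => c d /eqP.
  by rewrite addm0 mnmD_eq0 => /andP[->].
apply/idP/idP => [uf|f0].
  have : at_origin (f * f^-1) != 0.
    by rewrite divrr // /at_origin germ_series1 fps_coef1 eqxx oner_eq0.
  by rewrite mulE mulf_eq0 negb_or => /andP[].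
have [|||q qf] := @germ_division (@mdeg n) 0%MM 1 f 1.
- exact: mdegD.
- by move=> m; rewrite mul1n leqnn.
- by split=> // m _; rewrite -mdeg_eq0 mdeg0 lt0n.
apply/unitrPr; exists q; rewrite mulrC; apply/eqP; rewrite eq_sym -subr_eq0.
apply/eqP/germ_series_inj/fpsP => m.
by rewrite germ_series0 -[m]add0m qf.
Qed.

End Series.
End GermRing.

(** * Substitution of polynomials without constant term *)

Section Substitution.
Variables (k : fieldType) (n n' : nat) (lq : n.-tuple {mpoly k[n']}).

Definition vanish_below j (p : {mpoly k[n']}) :=
  forall m, (mdeg m < j)%N -> p@_m = 0.

Lemma vanish_belowM i j p q :
  vanish_below i p -> vanish_below j q -> vanish_below (i + j) (p * q).
Proof.
move=> pi qj m mij; rewrite mcoeffM big1 // => -[a b] /= /eqP mE.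
have [ai|ai] := ltnP (mdeg a) i; first by rewrite pi // mul0r.
rewrite [q@__]qj ?mulr0 //; have := congr1 (@mdeg n') mE.
by move: mij; rewrite mdegD => *; lia.
Qed.

Hypothesis lq0 : forall i, (tnth lq i)@_0%MM = 0.

Lemma vanish_below_compX a : vanish_below (mdeg a) ('X_[a] \mPo lq).
Proof.
rewrite comp_mpolyX mdegE; elim/big_rec2: _ => [|i d p _ IH]; first by [].
rewrite mulrC addnC; apply: vanish_belowM => //.
elim: (a i) => [|j IHj]; first by [].
rewrite exprS -add1n; apply: vanish_belowM => // m.
by rewrite ltnS leqn0 mdeg_eq0 => /eqP->.
Qed.

Lemma vanish_below_comp N (p : {mpoly k[n]}) :
  (forall m, (mdeg m < N)%N -> p@_m = 0) -> vanish_below N (p \mPo lq).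
Proof.
move=> pN m mN; rewrite comp_mpolyEX raddf_sum big1 // => a _ /=.
rewrite mcoeffZ; have [aN|aN] := ltnP (mdeg a) N.
  by rewrite pN ?mul0r.
by rewrite vanish_below_compX ?mulr0 //; apply: leq_trans aN.
Qed.

(** If the entries of [lq] have no constant term, substitution cannot lower degrees, so the
    coefficient at m is already that of a truncation beyond degree |m|. *)
Definition fps_subst (f : fps n k) : fps n' k :=
  Fps (fun m => (fps_trunc (mdeg m).+1 f \mPo lq)@_m).

Lemma fps_subst_agree N f p : fps_agree N f p -> fps_agree N (fps_subst f) (p \mPo lq).
Proof.
move=> fp m mN; apply/eqP; rewrite -subr_eq0 -mcoeffB -raddfB /=.
apply/eqP/(@vanish_below_comp (mdeg m).+1) => // a am.
rewrite mcoeffB fp ?fps_truncP ?subrr //.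
by apply: leq_trans am _.
Qed.

Lemma fps_subst_trunc N f :
  fps_agree N (fps_subst f) (fps_trunc N f \mPo lq).
Proof. exact/fps_subst_agree/fps_truncP. Qed.

Fact fps_subst_zmod : zmod_morphism fps_subst.
Proof.
move=> f g; apply: fps_agreeP => N.
exists ((fps_trunc N f - fps_trunc N g) \mPo lq).
  by apply: fps_subst_agree => m mN; rewrite mcoeffB !fps_truncP.
by rewrite raddfB => m mN; rewrite mcoeffB !fps_subst_trunc.
Qed.

Fact fps_subst_monoid : monoid_morphism fps_subst.
Proof.
split=> [|f g]; apply: fps_agreeP => N.
  exists (1 \mPo lq); first by apply: fps_subst_agree; apply: fps_agree1.
  by rewrite comp_mpoly1; apply: fps_agree1.
exists ((fps_trunc N f * fps_trunc N g) \mPo lq).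
  by apply: fps_subst_agree; apply: fps_agreeM; apply: fps_truncP.
by rewrite rmorphM; apply: fps_agreeM; apply: fps_subst_trunc.
Qed.

End Substitution.

Lemma fps_subst_comp (k : fieldType) n n' n'' (lq : n.-tuple {mpoly k[n']})
    (lr : n'.-tuple {mpoly k[n'']}) (f : fps n k) :
  (forall i, (tnth lq i)@_0%MM = 0) -> (forall i, (tnth lr i)@_0%MM = 0) ->
  fps_subst lr (fps_subst lq f) = fps_subst [tuple tnth lq i \mPo lr | i < n] f.
Proof.
move=> lq0 lr0; apply: fps_agreeP => N; exists (fps_trunc N f \mPo lq \mPo lr).
  exact/fps_subst_agree/fps_subst_trunc.
have -> : fps_trunc N f \mPo lq \mPo lr
        = fps_trunc N f \mPo [tuple tnth lq i \mPo lr | i < n].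
  rewrite (comp_mpolyEX _ lq) [RHS]comp_mpolyEX raddf_sum; apply: eq_bigr => m _ /=.
  rewrite !comp_mpolyZ !comp_mpolyX rmorph_prod; congr (_ *: _).
  by apply: eq_bigr => i _; rewrite rmorphXn /= tnth_mktuple.
apply: fps_subst_trunc => i; rewrite tnth_mktuple.
apply: (@vanish_below_comp _ _ _ _ lr0 1) => [m|]; last by rewrite mdeg0.
by rewrite ltnS leqn0 mdeg_eq0 => /eqP->.
Qed.

Lemma fps_subst_id (k : fieldType) n (f : fps n k) :
  fps_subst [tuple 'X_i | i < n] f = f.
Proof.
apply: fps_agreeP => N; exists (fps_trunc N f); last exact: fps_truncP.
rewrite -[X in fps_agree _ _ X]comp_mpoly_id.
by apply: fps_subst_trunc => i; rewrite tnth_mktuple mcoeffX mnm1_eq0.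
Qed.

Section ConvergentSubstitution.
Variables (R : realType) (k : fieldType) (v : complete_norm R k).
Variables (n n' : nat) (lq : n.-tuple {mpoly k[n']}).
Hypothesis lq0 : forall i, (tnth lq i)@_0%MM = 0.

(** Without constant term each monomial contributes a factor r^|m| <= r, so the norm tends to 0 with
    r; this brings the substituted polynomials into the polydisc of convergence. *)
Lemma bounded_poly (p : {mpoly k[n']}) : p@_0%MM = 0 ->
  exists2 K, 0 <= K & forall r : R, 0 < r -> r <= 1 ->
    weight_bounded v (fun m => r ^+ mdeg m) (r * K) (fps_poly p).
Proof.
move=> p0; exists (\sum_(m <- msupp p) v p@_m).
  by apply: sumr_ge0 => m _; apply: nrm_ge0.
move=> r r0 r1 s us; rewrite mulr_sumr.
rewrite (bigID (fun m => m \in msupp p)) /= [X in _ + X]big1 ?addr0 => [|m]; last first.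
  by move=> /memN_msupp_eq0->; rewrite nrm0 mul0r.
rewrite [leRHS](bigID (fun m => m \in s)) /= -big_filter -[X in _ <= X + _]big_filter.
rewrite (perm_big [seq m <- msupp p | m \in s]) /=; last first.
  apply: uniq_perm; rewrite ?filter_uniq ?msupp_uniq // => m.
  by rewrite !mem_filter andbC.
apply: (@le_trans _ _ (\sum_(m <- [seq m <- msupp p | m \in s]) r * v p@_m)).
  apply: ler_sum => m _ /=.
  have [->|m0] := eqVneq m 0%MM; first by rewrite p0 nrm0 mul0r mulr0.
  rewrite mulrC ler_wpM2r ?nrm_ge0 // -[leRHS]expr1.
  by rewrite ler_wiXn2l ?(ltW r0) // lt0n mdeg_eq0.
by rewrite lerDl sumr_ge0 // => m _; rewrite mulr_ge0 ?nrm_ge0 ?ltW.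
Qed.

Lemma bounded_polyC (w : 'X_{1..n'} -> R) c :
  w 0%MM = 1 -> weight_bounded v w (v c) (fps_poly c%:MP).
Proof.
move=> w0 s us; rewrite (bigID (pred1 0%MM)) /= [X in _ + X]big1 ?addr0 => [|m].
  rewrite -big_filter; case: (boolP (0%MM \in s)) => s0.
    by rewrite filter_pred1_uniq // big_seq1 w0 mulr1 mcoeffC eqxx mulr1.
  rewrite (eq_in_filter (a2 := pred0)) ?filter_pred0 ?big_nil ?nrm_ge0 // => m ms /=.
  by apply/negbTE; apply: contraNneq s0 => <-.
by rewrite mcoeffC eq_sym => /negPf->; rewrite mulr0 nrm0 mul0r.
Qed.

Lemma bounded_compX (r r0 : R) : 0 < r -> 0 < r0 ->
  (forall i, weight_bounded v (fun m => r ^+ mdeg m) r0 (fps_poly (tnth lq i))) ->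
  forall a, weight_bounded v (fun m => r ^+ mdeg m) (r0 ^+ mdeg a) (fps_poly ('X_[a] \mPo lq)).
Proof.
move=> r_gt0 r0_gt0 lqr a.
have w_ge0 (m : 'X_{1..n'}) : 0 <= r ^+ mdeg m by rewrite exprn_ge0 ?ltW.
have wD (b c : 'X_{1..n'}) : r ^+ mdeg (b + c)%MM = r ^+ mdeg b * r ^+ mdeg c.
  by rewrite mdegD exprD.
rewrite comp_mpolyX mdegE.
elim/big_rec2: _ => [|i d p _ IH].
  rewrite expr0 -mpolyC1 -[X in weight_bounded _ _ X](nrm1 v).
  by apply: bounded_polyC; rewrite mdeg0.
rewrite rmorphM exprD; apply: boundedM => //; rewrite rmorphXn.
elim: (a i) => [|j IHj].
  rewrite !expr0 -(rmorph1 (@fps_poly k n')) -mpolyC1 -[X in weight_bounded _ _ X](nrm1 v).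
  by apply: bounded_polyC; rewrite mdeg0.
by rewrite !exprS; apply: (boundedM w_ge0 wD (lqr i) IHj).
Qed.

(** Once every entry of [lq] has norm at most r0, the image of X^a has norm at most r0^|a|, and the
    sum for the substituted series is dominated by that of [f] at radius r0. *)
Lemma convergent_subst f : convergent v f -> convergent v (fps_subst lq f).
Proof.
move=> /convergent_weight_boundedP[r0 r0_gt0 [C fC]].
have [r r_gt0 lqr] : exists2 r : R, 0 < r &
  forall i, weight_bounded v (fun m => r ^+ mdeg m) r0 (fps_poly (tnth lq i)).
  have /fin_all_exists2[K K0 lqK] := fun i => bounded_poly (lq0 i).
  pose S := \sum_i K i; have S0 : 0 <= S by apply: sumr_ge0.
  (* S + 1 dominates every [K i] and is positive even when S = 0, so r K i <= r0. *)
  pose r := Num.min 1 (r0 / (S + 1)).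
  have r_gt0 : 0 < r by rewrite lt_min ltr01 divr_gt0 // ltr_wpDl.
  exists r => // i; have := lqK i r r_gt0; rewrite ge_min lexx => /(_ isT).
  apply: bounded_leC; apply: (@le_trans _ _ (r0 / (S + 1) * (S + 1))).
    apply: ler_pM; rewrite ?(ltW r_gt0) ?ge_min ?lexx ?orbT //.
    by rewrite /S (bigD1 i) //= -addrA lerDl addr_ge0 ?sumr_ge0.
  by rewrite divfK // lt0r_neq0 // ltr_wpDl.
apply/convergent_weight_boundedP; exists r => //; exists C => s us.
have [N sN] := seq_mdeg_bound s.
apply: (@le_trans _ _ (\sum_(m <- s) \sum_(a : 'X_{1..n < N})
    v (fcoef f a) * (v ('X_[a] \mPo lq)@_m * r ^+ mdeg m))).
  rewrite big_seq [leRHS]big_seq; apply: ler_sum => m ms.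
  rewrite -(fps_subst_trunc lq0 f (sN m ms)) /fps_trunc.
  rewrite (raddf_sum (comp_mpoly lq)) raddf_sum /=.
  apply: le_trans (ler_wpM2r _ (nrm_sum v _ _)) _; first by rewrite exprn_ge0 ?ltW.
  by rewrite mulr_suml; apply: ler_sum => a _; rewrite comp_mpolyZ mcoeffZ nrmM mulrA.
rewrite exchange_big /=.
have uN : uniq (map (@bmnm n N) (index_enum _)).
  by rewrite map_inj_uniq ?index_enum_uniq //; apply: val_inj.
apply: le_trans (fC _ uN); rewrite big_map; apply: ler_sum => a _.
by rewrite -mulr_sumr ler_wpM2l ?nrm_ge0 // bounded_compX.
Qed.

End ConvergentSubstitution.

(** * Separating weights, shears and restriction to an axis *)

(** Weights are built one coordinate at a time: minimise the last coordinate over S, then apply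
    induction to the exponents that attain this minimum. *)
Lemma separating_weights n (S : (nat -> nat) -> Prop) : (exists u, S u) ->
  exists (w a : nat -> nat), [/\ forall i, (0 < w i)%N, w 0%N = 1%N, S a &
    forall u, S u -> (exists2 i, (i < n)%N & u i != a i) ->
      (\sum_(i < n) w i * a i < \sum_(i < n) w i * u i)%N].
Proof.
elim: n S => [|n IH] S [u0 Su0].
  by exists (fun=> 1%N), u0; split=> // u _ [i]; rewrite ltn0.
have ex : exists j, `[< exists2 u, S u & u n = j >].
  by exists (u0 n); apply/asboolP; exists u0.
case: (ex_minnP ex) => j /asboolP[u1 Su1 u1n] jmin.
have [|w [a [w0 w1 [Sa an] amin]]] := IH (fun u => S u /\ u n = j); first by exists u1.
pose sg := (\sum_(i < n) w i * a i)%N.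
(* The last weight exceeds by one the weight of [a] on the earlier coordinates, so a unit increase
   of the last coordinate outweighs anything the others can save. *)
pose w' i := if (i < n)%N then w i else sg.+1.
have sum_w' u : (\sum_(i < n) w' i * u i = \sum_(i < n) w i * u i)%N.
  by apply: eq_bigr => i _; rewrite /w' ltn_ord.
have w'n : w' n = sg.+1 by rewrite /w' ltnn.
exists w', a; split=> //.
- by move=> i; rewrite /w'; case: ifP.
(* For n = 0 the sum [sg] is empty, so the new weight is 1. *)
- rewrite /w'; case: ltnP => // n0.
  by move: n0; rewrite leqn0 => /eqP n0; rewrite /sg big1 // => -[i /=]; rewrite n0.
move=> u Su [i]; rewrite ltnS !big_ord_recr /= !sum_w' w'n -/sg an => le_in ne_i.
have [un|un] := eqVneq (u n) j.
  have lt_in : (i < n)%N.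
    by rewrite ltn_neqAle le_in andbT; apply: contraNneq ne_i => ->; rewrite un an.
  have := amin u (conj Su un) (ex_intro2 _ _ i lt_in ne_i); rewrite un -/sg.
  by rewrite ltn_add2r.
have lt_jn : (j < u n)%N.
  by rewrite ltn_neqAle eq_sym un jmin //; apply/asboolP; exists u.
apply: (@leq_trans (sg.+1 * j.+1)); first by rewrite mulnS; lia.
by apply: leq_trans (leq_addl _ _); rewrite leq_mul2l lt_jn orbT.
Qed.

Definition wdeg n (w : 'I_n -> nat) (m : 'X_{1..n}) := (\sum_i w i * m i)%N.

Lemma wdegD n (w : 'I_n -> nat) a b : wdeg w (a + b)%MM = (wdeg w a + wdeg w b)%N.
Proof. by rewrite /wdeg -big_split; apply: eq_bigr => i _; rewrite mnmDE mulnDr. Qed.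

Lemma mdeg_le_wdeg n (w : 'I_n -> nat) m : (forall i, 0 < w i)%N -> (mdeg m <= wdeg w m)%N.
Proof. by move=> w0; rewrite mdegE; apply: leq_sum => i _; rewrite leq_pmull. Qed.

Lemma fps_separating_weights (A : comNzRingType) n (f : fps n.+1 A) : f != 0 ->
  exists (w : 'I_n.+1 -> nat) a, [/\ forall i, (0 < w i)%N, w ord0 = 1%N, fcoef f a != 0 &
    forall m, fcoef f m != 0 -> m != a -> (wdeg w a < wdeg w m)%N].
Proof.
move=> /fps_neq0_lowest[m0 fm0 _].
pose S u := exists2 m : 'X_{1..n.+1}, fcoef f m != 0 & u = nth 0%N m.
have [|w [u [w0 w1 [a fa ->] amin]]] := @separating_weights n.+1 S.
  by exists (nth 0%N m0), m0.
exists (fun i : 'I_n.+1 => w i), a; split=> // m fm ma.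
have := amin _ (ex_intro2 _ _ m fm erefl); rewrite /wdeg.
have E (c : 'X_{1..n.+1}) : \sum_(i < n.+1) (w i * nth 0 c i)%N = \sum_(i < n.+1) (w i * c i)%N.
  by apply: eq_bigr => i _; rewrite (mnm_nth 0%N).
rewrite !E; apply.
have [i ne_i] : exists i : 'I_n.+1, m i != a i.
  apply: contrapT => no; case/eqP: ma; apply/mnmP => i; apply/eqP.
  by apply/negP => /negP ne_i; apply: no; exists i.
by exists i => //; rewrite -!mnm_nth.
Qed.

(* With separating weights w, the shear x_i -> x_i + t^(w_i) followed by restriction
   to the t-axis maps distinct low monomials of f to distinct powers of t. *)
Section Shear.
Variables (k : fieldType) (n : nat).
Implicit Types (f : fps n.+1 k) (w : 'I_n.+1 -> nat) (c : k).

Definition shear w c : n.+1.-tuple {mpoly k[n.+1]} :=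
  [tuple if i == ord0 then 'X_ord0 else 'X_i + c *: 'X_ord0 ^+ w i | i < n.+1].

Definition restrict_axis : n.+1.-tuple {mpoly k[n.+1]} :=
  [tuple if i == ord0 then 'X_ord0 else 0 | i < n.+1].

Definition curve w : n.+1.-tuple {mpoly k[n.+1]} :=
  [tuple 'X_[U_(ord0) *+ w i] | i < n.+1].

Lemma shear0 w c : (forall i, 0 < w i)%N -> forall i, (tnth (shear w c) i)@_0%MM = 0.
Proof.
move=> w0 i; rewrite tnth_mktuple; case: ifP => _; first by rewrite mcoeffX mnm1_eq0.
rewrite mcoeffD mcoeffZ mcoeffX mnm1_eq0 mpolyXn mcoeffX.
case: eqP => [/(congr1 (@mdeg _))|_]; last by rewrite mulr0 addr0.
by rewrite mdegMn mdeg1 mul1n mdeg0 => w00; have := w0 i; rewrite w00.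
Qed.

Lemma restrict_axis0 i : (tnth restrict_axis i)@_0%MM = 0.
Proof.
by rewrite tnth_mktuple; case: ifP => _; rewrite ?mcoeff0 // mcoeffX mnm1_eq0.
Qed.

Lemma shearK w c f : (forall i, 0 < w i)%N ->
  fps_subst (shear w (- c)) (fps_subst (shear w c) f) = f.
Proof.
move=> w0; rewrite fps_subst_comp; try exact: shear0.
rewrite -[RHS]fps_subst_id; congr (fps_subst _ _).
apply: eq_from_tnth => i; rewrite !tnth_mktuple.
case: eqVneq => [->|i0]; first by rewrite comp_mpolyXU -tnth_nth tnth_mktuple eqxx.
rewrite raddfD /= comp_mpolyZ rmorphXn /= !comp_mpolyXU -!tnth_nth !tnth_mktuple.
by rewrite eqxx (negPf i0) scaleNr subrK.
Qed.

(** The shear fixes x_0 = t, so restricting it to the t-axis gives the monomial curve x_i = t^(w_i),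
    which also has x_0 = t because w_0 = 1. *)
Lemma axis_shear w f : (forall i, 0 < w i)%N -> w ord0 = 1%N ->
  fps_subst restrict_axis (fps_subst (shear w 1) f) = fps_subst (curve w) f.
Proof.
move=> w0 w1; rewrite fps_subst_comp; [|exact: shear0|exact: restrict_axis0].
congr (fps_subst _ _); apply: eq_from_tnth => i; rewrite !tnth_mktuple.
case: eqVneq => [->|i0].
  by rewrite comp_mpolyXU -tnth_nth tnth_mktuple eqxx w1 mulm1n.
rewrite raddfD /= comp_mpolyZ rmorphXn /= !comp_mpolyXU -!tnth_nth !tnth_mktuple.
by rewrite eqxx (negPf i0) add0r scale1r mpolyXn.
Qed.

Lemma curve0 w i : (forall i, 0 < w i)%N -> (tnth (curve w) i)@_0%MM = 0.
Proof.
move=> w0; rewrite tnth_mktuple mcoeffX.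
case: eqP => [/(congr1 (@mdeg _))|//].
by rewrite mdegMn mdeg1 mul1n mdeg0 => w00; have := w0 i; rewrite w00.
Qed.

Lemma fcoef_subst_axis g j :
  fcoef (fps_subst restrict_axis g) (U_(ord0) *+ j)%MM = fcoef g (U_(ord0) *+ j)%MM.
Proof.
have dj : (mdeg (U_(ord0 : 'I_n.+1) *+ j) < j.+1)%N by rewrite mdegMn mdeg1 mul1n.
rewrite -(fps_subst_trunc restrict_axis0 g dj) /fps_trunc.
rewrite (raddf_sum (comp_mpoly restrict_axis)) raddf_sum /=.
rewrite (bigD1 (BMultinom dj)) //= comp_mpolyZ comp_mpolyX mcoeffZ.
have axisX m : (forall i, i != ord0 -> m i = 0%N) ->
    \prod_(i < n.+1) tnth restrict_axis i ^+ m i = 'X_[U_(ord0) *+ m ord0].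
  move=> m0; rewrite (bigD1 ord0) //= tnth_mktuple eqxx mpolyXn big1 ?mulr1 // => i i0.
  by rewrite m0.
rewrite axisX => [|i i0]; last by rewrite mulmnE mnm1E eq_sym (negPf i0).
rewrite mulmnE mnm1E eqxx mul1n mcoeffX eqxx mulr1 big1 ?addr0 // => m ne_m.
rewrite comp_mpolyZ comp_mpolyX mcoeffZ.
have [m0|/existsNP[i /not_implyP[i0 mi]]] := pselect (forall i, i != ord0 -> bmnm m i = 0%N).
  have mE : bmnm m = (U_(ord0) *+ bmnm m ord0)%MM.
    apply/mnmP => i; rewrite mulmnE mnm1E eq_sym.
    by case: eqVneq => [->|i0]; rewrite ?mul1n // m0.
  by rewrite axisX // -mE mcoeffX [_ == _](negPf ne_m) mulr0.
rewrite (bigD1 i) //= tnth_mktuple (negPf i0) expr0n.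
by case: (m i) mi => // l _; rewrite mul0r mcoeff0 mulr0.
Qed.

Lemma curveX w m : 'X_[m] \mPo curve w = 'X_[U_(ord0) *+ wdeg w m].
Proof.
rewrite comp_mpolyX /wdeg; elim/big_rec2: _ => [|i e p _ ->]; first by rewrite mulm0n mpolyX0.
rewrite tnth_mktuple mpolyXn -mpolyXD; congr 'X_[_].
by apply/mnmP => l; rewrite mnmDE !mulmnE; lia.
Qed.

(** The weights are positive, so a monomial of weight j has degree at most j and the finite sum
    misses none. *)
Lemma fcoef_curve w f j : (forall i, 0 < w i)%N ->
  fcoef (fps_subst (curve w) f) (U_(ord0) *+ j)%MM
    = \sum_(m : 'X_{1..n.+1 < j.+1} | wdeg w (bmnm m) == j) fcoef f (bmnm m).
Proof.
move=> w0; have dj : (mdeg (U_(ord0 : 'I_n.+1) *+ j) < j.+1)%N by rewrite mdegMn mdeg1 mul1n.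
rewrite -(fps_subst_trunc (fun i => curve0 i w0) f dj) /fps_trunc.
rewrite (raddf_sum (comp_mpoly (curve w))) raddf_sum /= big_mkcond /=.
rewrite [RHS]big_mkcond; apply: eq_bigr => m _ /=.
rewrite comp_mpolyZ mcoeffZ curveX mcoeffX.
have -> : (U_(ord0) *+ wdeg w (bmnm m) == U_(ord0 : 'I_n.+1) *+ j)%MM = (wdeg w (bmnm m) == j).
  apply/eqP/eqP => [/(congr1 (@mdeg _))|->//].
  by rewrite !mdegMn mdeg1 !mul1n.
by case: eqP; rewrite ?mulr1 ?mulr0.
Qed.

End Shear.

(** * Gauss's lemma and coprime cancellation *)

Definition divides (A : comUnitRingType) (a b : A) := exists c, b = c * a.

Definition coprime_cancel (A : comUnitRingType) (f : A) :=
  forall g h, no_common_component f g -> divides f (g * h) -> divides f h.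

Section Divisibility.
Variable A : comUnitRingType.
Implicit Types a b c : A.

Lemma dividesD a b c : divides a b -> divides a c -> divides a (b + c).
Proof. by move=> [x ->] [y ->]; exists (x + y); rewrite mulrDl. Qed.

Lemma dividesN a b : divides a b -> divides a (- b).
Proof. by move=> [x ->]; exists (- x); rewrite mulNr. Qed.

Lemma dividesMl a b c : divides a b -> divides a (c * b).
Proof. by move=> [x ->]; exists (c * x); rewrite mulrA. Qed.

Lemma dividesMr a b c : divides a b -> divides a (b * c).
Proof. by rewrite mulrC; apply: dividesMl. Qed.

Lemma divides0 a : divides a 0.
Proof. by exists 0; rewrite mul0r. Qed.

Lemma divides_sum a (I : finType) (P : pred I) (F : I -> A) :
  (forall i, P i -> divides a (F i)) -> divides a (\sum_(i | P i) F i).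
Proof.
move=> aF; elim/big_rec: _ => [|i x Pi ax]; first exact: divides0.
exact: dividesD (aF i Pi) ax.
Qed.

End Divisibility.

(** * Primes and Gauss's lemma *)

Section Factorial.
Variables (A : idomainType) (mu : A -> nat).
Hypothesis muM : forall a b, a != 0 -> b != 0 -> mu (a * b) = (mu a + mu b)%N.
Hypothesis mu_unit : forall a, a != 0 -> mu a = 0%N -> a \is a GRing.unit.
Hypothesis cancelA : forall f : A, f != 0 -> coprime_cancel f.
Implicit Types (a b c : A) (p q : {poly A}).

Definition prime_element a :=
  [/\ a != 0, a \isn't a GRing.unit
    & forall x y, divides a (x * y) -> divides a x \/ divides a y].

Definition primitive_poly p := forall c, (forall i, divides c p`_i) -> c \is a GRing.unit.

(** Descent on [mu]: a proper factor has smaller measure. If [a] is irreducible and does not divide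
    x, every common divisor of [a] and x is a unit, so cancellation makes [a] prime. *)
Lemma prime_divisor a : a != 0 -> a \isn't a GRing.unit ->
  exists2 p, prime_element p & divides p a.
Proof.
elim: (mu a) {-2}a (leqnn (mu a)) => [|N IH] {}a.
  by rewrite leqn0 => /eqP mua a0; rewrite mu_unit.
move=> muN a0 ua.
have [irr|] := pselect (forall b c, a = b * c -> b \is a GRing.unit \/ c \is a GRing.unit).
  exists a; last by exists 1; rewrite mul1r.
  split=> // x y axy; have [ax|nax] := pselect (divides a x); first by left.
  right; apply: (@cancelA a a0 x y _ axy) => g [b ab] [c xc].
  case: (irr _ _ ab) => // ub; case: nax; exists (c * b^-1).
  by rewrite ab xc mulrA -[c * _ * b]mulrA mulVr // mulr1.
move=> /existsNP[b /existsNP[c /not_implyP[abc /not_orP[/negP ub /negP uc]]]].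
have /norP[b0 c0] : ~~ ((b == 0) || (c == 0)) by rewrite -mulf_eq0 -abc.
have mu0 : mu c != 0%N by apply: contraNneq uc => /(mu_unit c0).
have [|//|//|p pp pb] := IH b; first by move: muN; rewrite abc muM //; lia.
by exists p => //; rewrite abc; apply: dividesMr.
Qed.

Lemma divides_coefs a p : (forall i, divides a p`_i) -> exists q, p = a *: q.
Proof.
move=> /choice[c pc]; exists (\poly_(i < size p) c i); apply/polyP => i.
rewrite coefZ coef_poly; case: ltnP => [_|/leq_sizeP->//].
  by rewrite pc mulrC.
by rewrite mulr0.
Qed.

(** Take the first coefficients p_i and q_l not divisible by [a]: in the coefficient of index i + l
    every term except p_i q_l is divisible. *)
Lemma prime_divides_polyM a p q : prime_element a ->
  (forall i, divides a (p * q)`_i) ->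
  (forall i, divides a p`_i) \/ (forall i, divides a q`_i).
Proof.
move=> [a0 ua a_prime] apq; apply: contrapT => /not_orP[].
have least (r : {poly A}) : ~ (forall i, divides a r`_i) ->
    exists2 i, ~ divides a r`_i & forall j, (j < i)%N -> divides a r`_j.
  move=> /existsNP[i ri].
  have ex : exists i, `[< ~ divides a r`_i >] by exists i; apply/asboolP.
  case: (ex_minnP ex) => m /asboolP rm mle; exists m => // j jm.
  by apply: contrapT => /asboolP /mle; rewrite leqNgt jm.
move=> /least[i pi pj] /least[l ql qj].
have := apq (i + l)%N; rewrite coefM.
have lt_i : (i < (i + l).+1)%N by rewrite ltnS leq_addr.
rewrite (bigD1 (Ordinal lt_i)) //= addKn => aS.
have : divides a (p`_i * q`_l).
  rewrite -[_ * _](addrK (\sum_(j < (i + l).+1 | j != Ordinal lt_i) p`_j * q`_(i + l - j))).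
  apply: dividesD => //; apply/dividesN/divides_sum => j ji.
  have {ji} ji : j != i :> nat by [].
  have [lt_ji|lt_ij|eq_ji] := ltngtP j i; last by rewrite eq_ji eqxx in ji.
    by apply/dividesMr/pj.
  by apply/dividesMl/qj; have := ltn_ord j; lia.
by case/a_prime.
Qed.

(** Prime divisors of [a] are removed one at a time: such a prime divides all coefficients of
    [q * p], not all those of the primitive [p], hence all those of [q]. *)
Lemma gauss a p q r : a != 0 -> primitive_poly p -> q * p = a *: r -> exists q', q = a *: q'.
Proof.
move=> a0 prim_p; elim: (mu a) {-2}a (leqnn (mu a)) a0 q => [|N IH] {}a muN a0 q qp.
  have ua : a \is a GRing.unit by apply: mu_unit => //; apply/eqP; rewrite -leqn0.
  by exists (a^-1 *: q); rewrite scalerA divrr // scale1r.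
have [ua|ua] := boolP (a \is a GRing.unit).
  by exists (a^-1 *: q); rewrite scalerA divrr // scale1r.
have [c cp [b ab]] := prime_divisor a0 ua.
have [c0 uc _] := cp.
have b0 : b != 0 by apply: contraNneq a0; rewrite ab => ->; rewrite mul0r.
have [cq|cp'] : (forall i, divides c q`_i) \/ (forall i, divides c p`_i).
  apply: prime_divides_polyM => // i; rewrite qp coefZ ab.
  by apply/dividesMr/dividesMl; exists 1; rewrite mul1r.
- have [q1 q1E] := divides_coefs cq.
  have q1p : q1 * p = b *: r.
    apply: (@mulfI _ c%:P); rewrite ?polyC_eq0 // !mul_polyC.
    by rewrite scalerAl -q1E qp ab scalerA mulrC.
  have [|//|q' q'E] := IH b _ _ q1 q1p.
    have : mu c != 0%N by apply: contraNneq uc => /(mu_unit c0).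
    by move: muN; rewrite ab muM //; lia.
  by exists q'; rewrite q1E q'E scalerA ab mulrC.
by case/negP: uc; apply: prim_p.
Qed.

(** Each nonunit common divisor that is pulled out lowers the measure of the leading coefficient. *)
Lemma primitive_part p : p != 0 ->
  exists c p', [/\ p = c *: p', c != 0 & primitive_poly p'].
Proof.
elim: (mu _) {-2}p (leqnn (mu (lead_coef p))) => [|N IH] {}p muN p0.
all: have [prim|/existsNP[c /not_implyP[cp /negP uc]]] := pselect (primitive_poly p);
  first by exists 1, p; rewrite scale1r oner_eq0.
all: have [q qE] := divides_coefs cp.
all: have c0 : c != 0 by apply: contraNneq p0; rewrite qE => ->; rewrite scale0r.
all: have q0 : q != 0 by apply: contraNneq p0; rewrite qE => ->; rewrite scaler0.
all: have muc : mu c != 0%N by apply: contraNneq uc => /(mu_unit c0).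
all: have muE : mu (lead_coef p) = (mu c + mu (lead_coef q))%N
  by rewrite qE lead_coefZ muM ?lead_coef_eq0.
  by move: muN; rewrite muE; lia.
have [|//|b [p' [q'E b0 prim]]] := IH q; first by lia.
by exists (c * b), p'; rewrite -scalerA -q'E mulf_neq0.
Qed.

(** * Coprime cancellation from Weierstrass division *)

Section Weierstrass.
Variables (B : idomainType) (Lam : {rmorphism {poly A} -> B}) (f : B) (s : nat).
Hypothesis div_ex : forall h : B, exists (q : B) (p : {poly A}),
  h = q * f + Lam p /\ (size p <= s)%N.
Hypothesis div_uniq : forall (q : B) p, (size p <= s)%N -> Lam p = q * f -> p = 0.
Hypothesis f_assoc : exists (u : B) (w : {poly A}),
  [/\ u \is a GRing.unit, Lam w = u * f, w \is monic & size w = s.+1].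

(** The remainder of c h is c times the remainder of h, and uniqueness forces it to vanish. *)
Lemma divides_constM c h : c != 0 -> divides f (Lam c%:P * h) -> divides f h.
Proof.
move=> c0 [e ch]; have [q [p [hE sp]]] := div_ex h.
suff p0 : p = 0 by exists q; rewrite hE p0 rmorph0 addr0.
have cp : Lam (c *: p) = (e - Lam c%:P * q) * f.
  by rewrite -mul_polyC rmorphM mulrBl -ch hE mulrDr mulrA addrC addKr.
have /eqP := div_uniq (leq_trans (size_scale_leq c p) sp) cp.
by rewrite -mul_polyC mulf_eq0 polyC_eq0 (negPf c0) => /eqP.
Qed.

(* If f does not divide h, a primitive p of least size with f | g * Lam p divides the
   Weierstrass polynomial w of f by Gauss's lemma, and the cofactor w / p gives a
   common factor of f and g, not a unit since size p <= s. *)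
Lemma weierstrass_cancel : coprime_cancel f.
Proof.
have [u [w [uu wE w_mon sw]]] := f_assoc.
move=> g h cop fgh; apply: contrapT => nfh.
have [q0 [p0 [hE sp0]]] := div_ex h.
have ex : exists N, `[< exists p,
    [/\ size p = N, p != 0, (size p <= s)%N & divides f (g * Lam p)] >].
  exists (size p0); apply/asboolP; exists p0; split=> //.
    by apply: contra_notN nfh => /eqP p00; exists q0; rewrite hE p00 rmorph0 addr0.
  have -> : g * Lam p0 = g * h - g * q0 * f by rewrite hE; ring.
  by apply: dividesD fgh _; apply: dividesN; exists (g * q0).
case: (ex_minnP ex) => N /asboolP[p1 [sp1 p10 p1s fgp1]] minN.
have [c [p [p1E c0 prim]]] := primitive_part p10.
have sp : size p = N by rewrite -sp1 p1E size_scale.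
have p_neq0 : p != 0 by apply: contraNneq p10; rewrite p1E => ->; rewrite scaler0.
have fgp : divides f (g * Lam p).
  apply: (divides_constM c0); move: fgp1; rewrite p1E -mul_polyC rmorphM.
  by rewrite mulrCA.
have min_p (r : {poly A}) : (size r < size p)%N -> divides f (g * Lam r) -> r = 0.
  move=> rp fgr; apply/eqP; apply: contraTT (rp) => r0; rewrite -leqNgt sp.
  apply: minN; apply/asboolP; exists r; split=> //.
  by apply: leq_trans (ltnW rp) _; rewrite sp -sp1.
(* [p] need not be monic, hence a pseudo-division. As [Lam w] is a multiple of [f], the remainder
   again satisfies f | g * Lam r, and minimality of [p] forces r = 0. *)
pose r := Pdiv.Ring.rmodp w p; pose q := Pdiv.Ring.rdivp w p.
pose a := lead_coef p ^+ Pdiv.Ring.rscalp w p.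
have a0 : a != 0 by rewrite expf_neq0 ?lead_coef_eq0.
have awE : a *: w = q * p + r := Pdiv.ComRing.rdivp_eq p w.
have r0 : r = 0.
  apply: min_p; first exact: Pdiv.Ring.ltn_rmodpN0.
  have -> : g * Lam r = g * Lam a%:P * u * f - Lam q * (g * Lam p).
    have -> : r = a%:P * w - q * p by rewrite mul_polyC awE addrC addKr.
    by rewrite rmorphB !rmorphM wE; ring.
  apply: dividesD; first by exists (g * Lam a%:P * u).
  exact/dividesN/dividesMl.
have [q' q'E] : exists q', q = a *: q' by apply: (gauss a0 prim (r := w)); rewrite awE r0 addr0.
have q'p : q' * p = w.
  apply: (@mulfI _ a%:P); rewrite ?polyC_eq0 // !mul_polyC scalerAl -q'E.
  by rewrite awE r0 addr0.
have Lamp0 : Lam p != 0.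
  apply: contraNneq p_neq0 => Lp; apply/eqP/(@div_uniq 0); rewrite ?mul0r //.
  by rewrite sp -sp1.
have fE : f = u^-1 * Lam p * Lam q'.
  by apply: (mulrI uu); rewrite -wE -q'p rmorphM !mulrA divrr // mul1r mulrC.
have uq' : Lam q' \isn't a GRing.unit.
  apply: contraNN p_neq0 => uG; apply/eqP/(@div_uniq ((Lam q')^-1 * u)).
    by rewrite sp -sp1.
  by rewrite -mulrA -wE -q'p rmorphM mulKr.
case/negP: uq'; apply: cop; first by exists (u^-1 * Lam p).
case: fgp => e gpE; exists (e * u^-1); apply: (mulIf Lamp0).
by rewrite gpE fE; ring.
Qed.

End Weierstrass.
End Factorial.

Section GermSubstitution.
Variables (R : realType) (k : fieldType) (v : complete_norm R k) (kd : series_kind).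
Variables (n n' : nat) (lq : n.-tuple {mpoly k[n']}).
Hypothesis lq0 : forall i, (tnth lq i)@_0%MM = 0.

Definition germ_subst of (forall i, (tnth lq i)@_0%MM = 0) :=
  fun f : germ_ring v kd n => germ_of v kd (fps_subst lq (germ_series f)).

Lemma germ_series_subst f :
  germ_series (germ_subst lq0 f) = fps_subst lq (germ_series f).
Proof.
apply: germ_ofK; have := germ_series_convergent f.
rewrite /germ_convergent; case: kd f => //= f; exact: convergent_subst.
Qed.

Fact germ_subst_zmod : zmod_morphism (germ_subst lq0).
Proof.
move=> f g; apply: germ_series_inj.
by rewrite germ_seriesB !germ_series_subst germ_seriesB (fps_subst_zmod lq0).
Qed.
Fact germ_subst_monoid : monoid_morphism (germ_subst lq0).
Proof.
have [s1 sM] := fps_subst_monoid lq0.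
split=> [|f g]; apply: germ_series_inj.
  by rewrite germ_series_subst !germ_series1 s1.
by rewrite germ_seriesM !germ_series_subst germ_seriesM sM.
Qed.
HB.instance Definition _ := GRing.isZmodMorphism.Build
  (germ_ring v kd n) (germ_ring v kd n') (germ_subst lq0) germ_subst_zmod.
HB.instance Definition _ := GRing.isMonoidMorphism.Build
  (germ_ring v kd n) (germ_ring v kd n') (germ_subst lq0) germ_subst_monoid.

End GermSubstitution.

Section GermIntegralDomain.
Variables (R : realType) (k : fieldType) (v : complete_norm R k) (kd : series_kind).
Variable n : nat.
Notation O := (germ_ring v kd n).

Fact germ_integral : GRing.integral_domain_axiom O.
Proof. by move=> f g /germ_mulf_eq0[]->; rewrite eqxx ?orbT. Qed.

Definition germ_idomain : idomainType :=
  HB.pack (GRing.ComUnitRing.sort O)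
    (GRing.ComUnitRing_isIntegral.Build O germ_integral).

(** The order of vanishing, as the monomial order compares total degrees first; it serves as the
    measure [mu]. The default 0 is taken at the zero germ. *)
Definition germ_order (f : O) : nat :=
  if pselect (exists m, lowest_monomial (germ_series f) m) is left e
  then mdeg (sval (cid e)) else 0.

Lemma germ_orderE (f : O) m : lowest_monomial (germ_series f) m -> germ_order f = mdeg m.
Proof.
move=> [fm fle]; rewrite /germ_order; case: pselect => [e|[]]; last by exists m.
case: cid => /= a [fa ale]; congr mdeg.
by apply/le_anti; rewrite fle ?ale.
Qed.

Lemma germ_lowest (f : O) : f != 0 -> exists m, lowest_monomial (germ_series f) m.
Proof.
move=> f0; have [|m fm mle] := @fps_neq0_lowest _ _ (germ_series f); last by exists m.
by apply: contra_neq f0 => f0; apply: germ_series_inj; rewrite f0 germ_series0.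
Qed.

Lemma germ_orderM (f g : O) : f != 0 -> g != 0 ->
  germ_order (f * g) = (germ_order f + germ_order g)%N.
Proof.
move=> /germ_lowest[a fa] /germ_lowest[b gb].
rewrite (germ_orderE fa) (germ_orderE gb) -mdegD; apply: germ_orderE.
by rewrite germ_seriesM; apply: lowestM.
Qed.

Lemma germ_order_unit (f : O) : f != 0 -> germ_order f = 0%N -> f \is a GRing.unit.
Proof.
move=> /germ_lowest[a fa]; rewrite (germ_orderE fa) => /eqP; rewrite mdeg_eq0 => /eqP a0.
by rewrite germ_unitE /at_origin -a0; case: fa.
Qed.

End GermIntegralDomain.

(** * Germs regular in one variable *)

Section GermWeierstrass.
Variables (R : realType) (k : fieldType) (v : complete_norm R k) (kd : series_kind).
Variable n : nat.
Notation A := (germ_ring v kd n).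
Notation B := (germ_ring v kd n.+1).
Notation series := (@germ_series R k v kd _).
Notation subst l := (@germ_subst R k v kd _ _ _ l).
Implicit Types (a : 'X_{1..n}) (m : 'X_{1..n.+1}).

(* For these weights t^s is the only monomial of least weight of a series that has
   order s in t = x_0 on the t-axis. *)
Definition regular_weight (s : nat) (i : 'I_n.+1) := if i == ord0 then 1%N else s.+1.

Lemma regular_weight_gt0 s i : (0 < regular_weight s i)%N.
Proof. by rewrite /regular_weight; case: ifP. Qed.

Lemma wdeg_regular_le s m : (mdeg m <= wdeg (regular_weight s) m <= s.+1 * mdeg m)%N.
Proof.
rewrite mdeg_le_wdeg /= => [|i]; last exact: regular_weight_gt0.
rewrite mdegE big_distrr /=; apply: leq_sum => i _; rewrite leq_mul2r.
by apply/orP; right; rewrite /regular_weight; case: ifP.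
Qed.

Definition regular_in_X0 s (f : B) :=
  initial_at (wdeg (regular_weight s)) (U_(ord0) *+ s)%MM (series f).

Lemma wdeg_axis s j : wdeg (regular_weight s) (U_(ord0) *+ j)%MM = j.
Proof.
rewrite /wdeg (bigD1 ord0) //= big1 => [|i i0].
  by rewrite mulmnE mnm1E eqxx /regular_weight eqxx; lia.
by rewrite mulmnE mnm1E eq_sym (negPf i0) !mul0n muln0.
Qed.

(** A monomial off the t-axis contains a variable of weight s + 1, and the powers of t below t^s are
    absent by hypothesis. *)
Lemma regular_axis s (f : B) : fcoef (series f) (U_(ord0) *+ s)%MM != 0 ->
  (forall j, (j < s)%N -> fcoef (series f) (U_(ord0) *+ j)%MM = 0) -> regular_in_X0 s f.
Proof.
move=> fs fj; split=> // m fm ms; rewrite wdeg_axis.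
have [m0|/existsNP[i /not_implyP[i0 mi]]] := pselect (forall i, i != ord0 -> m i = 0%N).
  have mE : m = (U_(ord0) *+ m ord0)%MM.
    apply/mnmP => i; rewrite mulmnE mnm1E eq_sym.
    by case: eqVneq => [->|i0]; rewrite ?mul1n // m0.
  rewrite mE wdeg_axis ltnNge leq_eqVlt; apply/norP; split.
    by apply: contra ms => /eqP <-; apply/eqP.
  by apply: contra fm => lt_s; rewrite mE fj.
rewrite /wdeg (bigD1 i) //= /regular_weight (negPf i0); apply: leq_trans (leq_addr _ _).
by rewrite leq_pmulr // lt0n; apply/eqP.
Qed.

(** After the shear, the coefficient of t^j on the axis is the sum of the coefficients of [f] of
    weight j: a single nonzero term at the lightest exponent, nothing below it. *)
Lemma germ_regular (f : B) : f != 0 ->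
  exists (phi psi : {rmorphism B -> B}) s,
    [/\ cancel phi psi, cancel psi phi & regular_in_X0 s (phi f)].
Proof.
move=> f0; have /fps_separating_weights[w [a [w0 w1 fa amin]]] : series f != 0.
  by apply: contra_neq f0 => f0; apply: germ_series_inj; rewrite f0 germ_series0.
exists (subst (shear0 1 w0)), (subst (shear0 (-1) w0)), (wdeg w a).
split=> [g|g|].
- by apply: germ_series_inj; rewrite !germ_series_subst shearK.
- apply: germ_series_inj; rewrite !germ_series_subst.
  by have := shearK (-1) (series g) w0; rewrite opprK.
have coefE j : fcoef (series (subst (shear0 1 w0) f)) (U_(ord0) *+ j)%MM
    = \sum_(m : 'X_{1..n.+1 < j.+1} | wdeg w (bmnm m) == j) fcoef (series f) (bmnm m).
  by rewrite germ_series_subst -fcoef_subst_axis axis_shear // fcoef_curve.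
apply: regular_axis => [|j lt_j]; rewrite coefE.
  have da : (mdeg a < (wdeg w a).+1)%N by rewrite ltnS mdeg_le_wdeg.
  rewrite (bigD1 (BMultinom da)) //= big1 ?addr0 // => m /andP[/eqP wm ne_m].
  apply: contraNeq ne_m => fm; rewrite -val_eqE /=.
  by apply: contraT => /(amin _ fm); rewrite wm ltnn.
rewrite big1 // => m /eqP wm; apply: contraTeq lt_j => fm; rewrite -wm -leqNgt.
by have [->//|/(amin _ fm)/ltnW] := eqVneq (bmnm m) a.
Qed.

Definition lift_mnm a : 'X_{1..n.+1} :=
  [multinom (if unlift ord0 i is Some j then a j else 0%N) | i < n.+1].

Lemma lift_mnm0 a : lift_mnm a ord0 = 0%N.
Proof. by rewrite mnmE unlift_none. Qed.

Lemma lift_mnm_lift a j : lift_mnm a (lift ord0 j) = a j.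
Proof. by rewrite mnmE liftK. Qed.

Definition tail_mnm m : 'X_{1..n} := [multinom m (lift ord0 j) | j < n].

Lemma lift_tail m : m = (U_(ord0) *+ m ord0 + lift_mnm (tail_mnm m))%MM.
Proof.
apply/mnmP => i; rewrite mnmDE mulmnE mnm1E.
case: (unliftP ord0 i) => [j|]->; first by rewrite lift_mnm_lift mnmE.
by rewrite eqxx mul1n lift_mnm0 addn0.
Qed.

Lemma tail_lift a : tail_mnm (lift_mnm a) = a.
Proof. by apply/mnmP => j; rewrite mnmE lift_mnm_lift. Qed.

Lemma mdeg_lift a : mdeg (lift_mnm a) = mdeg a.
Proof.
rewrite !mdegE big_ord_recl lift_mnm0 add0n.
by apply: eq_bigr => j _; rewrite lift_mnm_lift.
Qed.

Definition lift_vars : n.-tuple {mpoly k[n.+1]} := [tuple 'X_(lift ord0 i) | i < n].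

Lemma lift_vars0 i : (tnth lift_vars i)@_0%MM = 0.
Proof. by rewrite tnth_mktuple mcoeffX mnm1_eq0. Qed.

Lemma lift_varsX a : 'X_[a] \mPo lift_vars = 'X_[lift_mnm a].
Proof.
rewrite comp_mpolyX [RHS]mpolyXE_id big_ord_recl lift_mnm0 expr0 mul1r.
by apply: eq_bigr => i _; rewrite tnth_mktuple lift_mnm_lift.
Qed.

Definition germ_lift : {rmorphism A -> B} := subst lift_vars0.

Lemma fcoef_germ_lift (a : A) m :
  fcoef (series (germ_lift a)) m = if m ord0 == 0%N then fcoef (series a) (tail_mnm m) else 0.
Proof.
rewrite germ_series_subst -(fps_subst_trunc lift_vars0 _ (ltnSn _)) /fps_trunc.
rewrite (raddf_sum (comp_mpoly lift_vars)) raddf_sum /=.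
case: eqP => m0.
  have mE : lift_mnm (tail_mnm m) = m by rewrite [RHS]lift_tail m0 mulm0n add0m.
  have dm : (mdeg (tail_mnm m) < (mdeg m).+1)%N by rewrite -mdeg_lift mE.
  rewrite (bigD1 (BMultinom dm)) //= comp_mpolyZ lift_varsX mcoeffZ mcoeffX.
  rewrite mE eqxx mulr1 big1 ?addr0 // => b ne_b.
  rewrite comp_mpolyZ lift_varsX mcoeffZ mcoeffX.
  case: eqP => [E|_]; last by rewrite mulr0.
  by case/eqP: ne_b; apply: val_inj; rewrite -[LHS]tail_lift E.
rewrite big1 // => b _; rewrite comp_mpolyZ lift_varsX mcoeffZ mcoeffX.
by case: eqP => [E|_]; [case: m0; rewrite -E lift_mnm0 | rewrite mulr0].
Qed.

End GermWeierstrass.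

(** * Weierstrass preparation and induction on the number of variables *)

Section GermUFD.
Variables (R : realType) (k : fieldType) (v : complete_norm R k) (kd : series_kind).

Section Step.
Variable n : nat.
Notation A := (germ_ring v kd n).
Notation B := (germ_ring v kd n.+1).
Notation series := (@germ_series R k v kd _).
Implicit Types p : {poly A}.

Lemma germ_convergent_X0 : @germ_convergent R k v kd n.+1 (fps_poly 'X_ord0).
Proof.
rewrite /germ_convergent; case: kd => //.
have [|K _ XK] := @bounded_poly R k v n.+1 'X_ord0; first by rewrite mcoeffX mnm1_eq0.
by apply/convergent_weight_boundedP; exists 1 => //; exists (1 * K); apply: XK.
Qed.

Definition germ_X0 : B := germ_of v kd (fps_poly 'X_ord0).

Lemma germ_series_X0 i : series (germ_X0 ^+ i) = fps_poly 'X_[U_(ord0) *+ i].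
Proof.
elim: i => [|i IH]; first by rewrite expr0 mulm0n mpolyX0 germ_series1 rmorph1.
rewrite exprS germ_seriesM IH germ_ofK; last exact: germ_convergent_X0.
by rewrite mulmS mpolyXD rmorphM.
Qed.

Definition germ_poly : {rmorphism {poly A} -> B} :=
  horner_eval germ_X0 \o map_poly (germ_lift v kd n).

Lemma germ_polyE p N : (size p <= N)%N ->
  germ_poly p = \sum_(i < N) germ_lift v kd n p`_i * germ_X0 ^+ i.
Proof.
move=> pN; rewrite /= /horner_eval (@horner_coef_wide _ N).
  by apply: eq_bigr => i _; rewrite coef_map.
by apply/leq_sizeP => j /(leq_sizeP _ _ pN) pj; rewrite coef_map /= pj rmorph0.
Qed.

Lemma fcoef_germ_poly p m :
  fcoef (series (germ_poly p)) m = fcoef (series p`_(m ord0)) (tail_mnm m).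
Proof.
rewrite (@germ_polyE p (maxn (size p) (m ord0).+1)) ?leq_maxl //.
rewrite germ_series_sum.
have fcoef_sum (I : finType) (F : I -> fps n.+1 k) :
    fcoef (\sum_i F i) m = \sum_i fcoef (F i) m.
  by apply: (big_morph (fun f => fcoef f m)).
rewrite fcoef_sum (bigD1 (Ordinal (leq_maxr (size p) (m ord0).+1))) //=.
have coefE i c : fcoef (series (germ_lift v kd n c * germ_X0 ^+ i)) m
    = if m ord0 == i then fcoef (series c) (tail_mnm m) else 0.
  rewrite germ_seriesM germ_series_X0 mulrC.
  have [le_im|nle_im] := leqP i (m ord0); last first.
    rewrite fps_coefXM_eq0 ?ltn_eqF //; apply/negP => /mnm_lepP /(_ ord0).
    by rewrite mulmnE mnm1E eqxx mul1n leqNgt nle_im.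
  have mE : m = (U_(ord0) *+ i + (m - U_(ord0) *+ i))%MM.
    rewrite addmC submK //; apply/mnm_lepP => j; rewrite mulmnE mnm1E.
    by case: eqP => [<-|]; rewrite ?mul1n.
  rewrite {1}mE fps_coefXM fcoef_germ_lift mnmBE mulmnE mnm1E eqxx mul1n subn_eq0 leqNgt.
  rewrite ltn_neqAle le_im andbT negbK eq_sym; case: eqP => // mi; congr fcoef.
  by apply/mnmP => j; rewrite !mnmE mulmnE mnm1E subn0.
rewrite coefE eqxx big1 ?addr0 // => i ne_i; rewrite coefE.
by case: eqP => // mi; case/eqP: ne_i; apply: val_inj.
Qed.

Lemma germ_poly_inj p : germ_poly p = 0 -> p = 0.
Proof.
move=> p0; apply/polyP => i; rewrite coef0; apply: germ_series_inj.
apply: fpsP => a; have := fcoef_germ_poly p (U_(ord0) *+ i + lift_mnm a)%MM.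
rewrite p0 mnmDE mulmnE mnm1E eqxx mul1n lift_mnm0 addn0 !germ_series0 => E.
apply: etrans (esym E); congr fcoef; apply/mnmP => j.
by rewrite mnmE mnmDE mulmnE mnm1E lift_mnm_lift.
Qed.

Lemma germ_poly_surj s (g : B) :
  (forall m : 'X_{1..n.+1}, (s <= m ord0)%N -> fcoef (series g) m = 0) ->
  exists2 p, g = germ_poly p & (size p <= s)%N.
Proof.
move=> g0; pose slice i : fps n k :=
  Fps (fun a => fcoef (series g) (U_(ord0) *+ i + lift_mnm a)%MM).
(* The slice at x_0^i sums over part of the monomials of [g], at the cost of a factor r^(-i). *)
have slice_conv i : @germ_convergent R k v kd n (slice i).
  have := germ_series_convergent g; rewrite /slice /germ_convergent.
  case: kd g {g0 slice} => // g /convergent_weight_boundedP[r r0 [C gC]].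
  apply/convergent_weight_boundedP; exists r => //; exists ((r ^+ i)^-1 * C) => s' us.
  pose phi a : 'X_{1..n.+1} := (U_(ord0) *+ i + lift_mnm a)%MM.
  have uphi : uniq (map phi s').
    rewrite map_inj_uniq // => a b /addmI/(congr1 (@tail_mnm n)).
    by rewrite !tail_lift.
  have := gC _ uphi; rewrite big_map ler_pdivlMl ?exprn_gt0 // mulr_sumr.
  apply: le_trans; apply: ler_sum => a _.
  by rewrite mdegD mdegMn mdeg1 mul1n mdeg_lift exprD mulrCA.
exists (\poly_(i < s) germ_of v kd (slice i)); last exact: size_poly.
apply: germ_series_inj; apply: fpsP => m; rewrite fcoef_germ_poly coef_poly.
case: ltnP => [_|/g0->]; last by rewrite germ_series0.
by rewrite germ_ofK // [in LHS](lift_tail m).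
Qed.

Section Regular.
Variables (s : nat) (f : B).
Hypothesis f_reg : regular_in_X0 s f.

Lemma regular_division (h : B) : exists (q : B) p, h = q * f + germ_poly p /\ (size p <= s)%N.
Proof.
have [q qP] := germ_division h (wdegD _) (@wdeg_regular_le n s) f_reg.
have [|p hE sp] := @germ_poly_surj s (h - q * f).
  move=> m sm; rewrite -[m](@submK _ (U_(ord0) *+ s)%MM) 1?addmC ?qP //.
  by apply/mnm_lepP => j; rewrite mulmnE mnm1E; case: eqP => [<-|]; rewrite ?mul1n.
by exists q, p; rewrite -hE addrC subrK.
Qed.

Lemma regular_division_unique (q : B) p : (size p <= s)%N -> germ_poly p = q * f -> p = 0.
Proof.
move=> sp pE; apply: germ_poly_inj; rewrite pE.
suff -> : q = 0 by rewrite mul0r.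
apply: germ_series_inj; rewrite germ_series0.
apply: (@division_unique _ _ (wdeg (regular_weight s)) _ _ (wdegD _) f_reg) => m.
rewrite -germ_seriesM -pE fcoef_germ_poly nth_default ?germ_series0 //.
by apply: leq_trans sp _; rewrite mnmDE mulmnE mnm1E eqxx mul1n leq_addl.
Qed.

(** Weierstrass preparation: divide x_0^s by [f]. A proper divisor of x_0^s has smaller weight and
    is absent from [f], so the coefficient at x_0^s reads 1 = u(0) f_s and the quotient u is a
    unit. *)
Lemma regular_weierstrass : exists (u : B) (w : {poly A}),
  [/\ u \is a GRing.unit, germ_poly w = u * f, w \is monic & size w = s.+1].
Proof.
have [u [p [XE sp]]] := regular_division (germ_X0 ^+ s).
exists u, ('X^s - p); split.
- have := congr1 (fun g => fcoef (series g) (U_(ord0) *+ s)%MM) XE.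
  rewrite germ_series_X0 fps_coef_poly mcoeffX eqxx germ_seriesD germ_seriesM fps_coefD.
  rewrite fcoef_germ_poly mulmnE mnm1E eqxx mul1n nth_default // germ_series0 addr0.
  have [_ f_gt] := f_reg.
  rewrite -[(U_(ord0) *+ s)%MM]add0m fps_coefM_single => [E|c d cd c0].
    rewrite germ_unitE; apply: contra_eq_neq E; rewrite /at_origin => ->.
    by rewrite mul0r oner_neq0.
  have [->|fd] := eqVneq (fcoef (series f) d) 0; first by rewrite mulr0.
  have [ds|ds] := eqVneq d (U_(ord0) *+ s)%MM.
    by case/eqP: c0; move: cd; rewrite ds => /addIm.
  have := f_gt d fd ds; rewrite add0m in cd; rewrite -cd wdegD.
  by rewrite ltnNge leq_addl.
- have XsE : germ_poly 'X^s = germ_X0 ^+ s.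
    by rewrite rmorphXn; congr (_ ^+ _); rewrite /= /horner_eval map_polyX hornerX.
  by rewrite rmorphB XsE XE addrK.
- rewrite monicE lead_coefDl ?lead_coefXn // size_polyN size_polyXn.
  exact: leq_ltn_trans sp _.
- rewrite size_polyDl ?size_polyXn // size_polyN; exact: leq_ltn_trans sp _.
Qed.

End Regular.
End Step.

(** The shear is a ring automorphism, so coprimality and divisibility pass to the regular germ
    [phi f]; in zero variables a nonzero germ is a unit. *)
Lemma germ_coprime_cancel n (f : germ_ring v kd n) : f != 0 -> coprime_cancel f.
Proof.
elim: n f => [|n IH] f f0.
  move=> g h _ _; have uf : f \is a GRing.unit.
    have [m [fm _]] := germ_lowest f0.
    have m0 : m = 0%MM by apply/mnmP => -[].
    by rewrite germ_unitE /at_origin -m0.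
  by exists (h * f^-1); rewrite mulrVK.
have [phi [psi [s [phiK psiK reg]]]] := germ_regular f0.
have cancel_phi : coprime_cancel (phi f).
  exact: (@weierstrass_cancel (germ_idomain v kd n) (@germ_order R k v kd n)
    (@germ_orderM _ _ _ _ _) (@germ_order_unit _ _ _ _ _) IH (germ_idomain v kd n.+1)
    (germ_poly n) (phi f) s (regular_division reg) (regular_division_unique reg)
    (regular_weierstrass reg)).
move=> g h cop [e fe]; have [||q hE] := cancel_phi (phi g) (phi h).
- move=> c [x fx] [y gy]; have uc : psi c \is a GRing.unit.
    by apply: cop; [exists (psi x)|exists (psi y)]; rewrite -rmorphM -?fx -?gy phiK.
  by rewrite -[c]psiK rmorph_unit.
- by exists (phi e); rewrite -!rmorphM fe.
by exists (psi q); rewrite -[h]phiK hE rmorphM phiK.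
Qed.

End GermUFD.

(** * Block decomposition of matrices *)

Section IdempotentMatrix.
Variables (k : fieldType) (d : nat).

(** From the rank factorisation P = L J U, the columns of L J span the image and those of U^-1 (1 -
    J) the kernel. Idempotency gives J U L J = J, so for their sum T the matrix U T is 1 plus a
    matrix of square zero, and T is invertible. *)
Lemma idempotent_diag (P : 'M[k]_d) : P *m P = P ->
  exists r T, [/\ (r <= d)%N, T \in unitmx & P *m T = T *m pid_mx r].
Proof.
move=> PP; pose J : 'M[k]_d := pid_mx (\rank P).
have rd : (\rank P <= d)%N by apply: rank_leq_row.
have JJ : J *m J = J by apply: pid_mx_id.
have PE : col_ebase P *m J *m row_ebase P = P by apply: mulmx_ebase.
set L := col_ebase P in PE; set U := row_ebase P in PE.
have uL : L \in unitmx by apply: col_ebase_unit.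
have uU : U \in unitmx by apply: row_ebase_unit.
have JULJ : J *m (U *m L) *m J = J.
  apply: (can_inj (mulKmx uL)); apply: (can_inj (mulmxK uU)).
  by move: PP; rewrite -{1 2 3}PE !mulmxA.
pose T := L *m J + invmx U *m (1%:M - J).
exists (\rank P), T; split=> //; last first.
  rewrite -/J /T mulmxDr mulmxDl -!mulmxA JJ mulmxBl mul1mx JJ subrr mulmx0 addr0.
  rewrite -{1 2}PE -!mulmxA (mulKVmx uU) mulmxBr mulmx1 JJ subrr mulmx0 addr0.
  by congr (_ *m _); rewrite -[RHS]JULJ !mulmxA.
pose Y := (U *m L - 1%:M) *m J.
have YY : Y *m Y = 0.
  have JJ0 : J *m ((U *m L - 1%:M) *m J) = 0.
    by rewrite mulmxA mulmxBr mulmx1 mulmxBl JULJ JJ subrr.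
  by rewrite {1}/Y -mulmxA JJ0 mulmx0.
have UT : U *m T = 1%:M + Y.
  rewrite /T mulmxDr (mulKVmx uU) /Y mulmxBl mul1mx !mulmxA.
  by rewrite addrCA.
have : U *m T \in unitmx.
  rewrite UT; apply: (proj1 (@mulmx1_unit _ _ _ (1%:M - Y) _)).
  by rewrite mulmxBr mulmx1 mulmxDl mul1mx YY addr0 addrK.
by rewrite unitmx_mul uU.
Qed.

End IdempotentMatrix.

Lemma mxtrace_pid (A : pzRingType) d r : (r <= d)%N -> \tr (pid_mx r : 'M[A]_d) = r%:R.
Proof.
move=> rd; rewrite /mxtrace (eq_bigr (fun i : 'I_d => (i < r)%N%:R)); last first.
  by move=> i _; rewrite mxE eqxx.
rewrite -natr_sum -[r in RHS]card_ord -sum1_card (big_ord_widen _ (fun=> 1%N) rd).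
by rewrite [in RHS]big_mkcond; congr _%:R; apply: eq_bigr => i _; case: ltnP.
Qed.

Lemma commute_pid_block (A : comUnitRingType) d r (M : 'M[A]_d) : (r <= d)%N ->
  M *m pid_mx r = pid_mx r *m M ->
  exists d2 (e : (r + d2)%N = d) (M1 : 'M[A]_r) (M2 : 'M[A]_d2),
    M = castmx (e, e) (block_mx M1 0 0 M2).
Proof.
move=> rd MJ; have [d2 e] : exists d2, (r + d2)%N = d by exists (d - r)%N; rewrite subnKC.
exists d2, e; case: d / e M MJ {rd} => M.
rewrite pid_mx_block -[M]submxK !mulmx_block !mulmx0 !mul0mx !mulmx1 !mul1mx !addr0.
case/eq_block_mx => _ ur dl _; exists (ulsubmx M), (drsubmx M).
by rewrite castmx_id submxK -[LHS]submxK -ur dl.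
Qed.

Lemma natr_inj_pchar0 (k : fieldType) :
  [pchar k] =i pred0 -> injective (fun n => n%:R : k).
Proof.
move=> /pcharf0P k0 m n; wlog le_mn : m n / (m <= n)%N => [IH E|/= E].
  by case: (leqP m n) => [|/ltnW] le; [exact: IH | apply/esym/IH].
apply/eqP; rewrite eqn_leq le_mn -subn_eq0 -k0 natrB //.
by rewrite -E subrr eqxx.
Qed.

Section DiagonalBlocks.
Variables (A : comUnitRingType) (d d1 d2 : nat) (e : (d1 + d2)%N = d).
Variables (M1 : 'M[A]_d1) (M2 : 'M[A]_d2).
Let M := castmx (e, e) (block_mx M1 0 0 M2).

Lemma det_diag_block : \det M = \det M1 * \det M2.
Proof. by rewrite /M; case: d / e; rewrite castmx_id det_lblock. Qed.

Lemma diag_block_entries (P : A -> Prop) : (forall i j, P (M i j)) ->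
  (forall i j, P (M1 i j)) /\ (forall i j, P (M2 i j)).
Proof.
rewrite /M; case: d / e; rewrite castmx_id => PM; split=> i j.
  by have := PM (lshift d2 i) (lshift d2 j); rewrite block_mxEul.
by have := PM (rshift d1 i) (rshift d1 j); rewrite block_mxEdr.
Qed.

(** The upper left blocks give M1 W11 = c, whence the determinant of [M1] divides a power of c. *)
Lemma diag_block_detl (W : 'M_d) c :
  M *m W = c *: pid_mx d1 -> exists x, \det M1 * x = c ^+ d1.
Proof.
rewrite /M; move: W; case: d / e => W; rewrite castmx_id -[W]submxK mulmx_block.
rewrite pid_mx_block scale_block_mx => /eq_block_mx[E _ _ _].
exists (\det (ulsubmx W)); rewrite -det_mulmx -[RHS]mulr1 -(det1 A d1) -detZ.
by move: E; rewrite mul0mx addr0 => ->.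
Qed.

Lemma diag_block_detr (W : 'M_d) c :
  M *m W = c *: (1%:M - pid_mx d1) -> exists x, \det M2 * x = c ^+ d2.
Proof.
rewrite /M; move: W; case: d / e => W; rewrite castmx_id -[W]submxK mulmx_block.
rewrite pid_mx_block scalar_mx_block opp_block_mx add_block_mx scale_block_mx.
move=> /eq_block_mx[_ _ _ E].
exists (\det (drsubmx W)); rewrite -det_mulmx -[RHS]mulr1 -(det1 A d2) -detZ.
by move: E; rewrite mul0mx add0r oppr0 addr0 => ->.
Qed.

End DiagonalBlocks.

(** [b] divides a power of [u * f], and [f] can be cancelled modulo [g]; therefore so can [b]. *)
Lemma divides_cancel_factor (A : comUnitRingType) (f g u a b y : A) n :
  u \is a GRing.unit -> (forall h, divides g (f * h) -> divides g h) ->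
  b * y = (u * f) ^+ n -> divides g (a * b) -> divides g a.
Proof.
move=> uu gf by_ gab; have : divides g (f ^+ n * a).
  have -> : f ^+ n * a = (u ^+ n)^-1 * y * (a * b).
    have -> : (u ^+ n)^-1 * y * (a * b) = (u ^+ n)^-1 * (b * y) * a by ring.
    by rewrite by_ exprMn mulKr ?unitrX.
  exact: dividesMl.
elim: n {by_} => [|n IH]; first by rewrite expr0 mul1r.
by rewrite exprS -mulrA => /gf/IH.
Qed.

(** * Splitting a saturated matrix over a local domain *)

Section BlockDecomposition.
Variables (O : idomainType) (k : fieldType).
Variables (ev : {rmorphism O -> k}) (cst : {rmorphism k -> O}).
Hypothesis evK : cancel cst ev.
Hypothesis ev_unit : forall x, (x \is a GRing.unit) = (ev x != 0).
Hypothesis pchar_k : [pchar k] =i pred0.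

Lemma unitmx_ev d (C : 'M[O]_d) : (C \in unitmx) = (map_mx ev C \in unitmx).
Proof. by rewrite !unitmxE ev_unit det_map_mx unitfE. Qed.

Lemma scalemx_inj (c : O) m n : c != 0 -> injective (fun A : 'M[O]_(m, n) => c *: A).
Proof.
move=> c0 A B /matrixP AB; apply/matrixP => i j.
by have := AB i j; rewrite !mxE; apply: mulfI.
Qed.

Lemma mulmx_det_inj d n (M : 'M[O]_d) : \det M != 0 -> injective (fun A : 'M[O]_(d, n) => M *m A).
Proof.
move=> M0 A B AB; apply: (scalemx_inj M0); rewrite -!mul_scalar_mx -mul_adj_mx.
by rewrite -!mulmxA AB.
Qed.

(* Modulo the maximal ideal C is an eigenbasis of P, hence C is invertible. *)
Lemma adapted_frame d (P : 'M[O]_d) :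
  map_mx ev P *m map_mx ev P = map_mx ev P ->
  exists r (C X : 'M[O]_d), let J := pid_mx r : 'M[O]_d in
    [/\ (r <= d)%N, C \in unitmx, C *m J = P *m X *m J
      & C *m (1%:M - J) = (1%:M - P) *m X *m (1%:M - J)].
Proof.
move=> /idempotent_diag[r [T [rd uT PT]]].
pose J : 'M[O]_d := pid_mx r; have JJ : J *m J = J by apply: pid_mx_id.
have J0 : (1%:M - J) *m J = 0 by rewrite mulmxBl mul1mx JJ subrr.
have J0' : J *m (1%:M - J) = 0 by rewrite mulmxBr mulmx1 JJ subrr.
have J1 : (1%:M - J) *m (1%:M - J) = 1%:M - J by rewrite mulmxBr mulmx1 J0 subr0.
pose X := map_mx cst T.
have evX : map_mx ev X = T by apply/matrixP => i j; rewrite !mxE evK.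
have evJ : map_mx ev J = pid_mx r by rewrite map_pid_mx.
exists r, (P *m X *m J + (1%:M - P) *m X *m (1%:M - J)), X; split=> //.
- rewrite unitmx_ev map_mxD !map_mxM !map_mxB !map_mx1 evX evJ PT.
  rewrite !mulmxBl !mul1mx PT -[T *m _ *m pid_mx r]mulmxA pid_mx_id //.
  rewrite mulmxBr mulmx1 mulmxBr mulmx1 -[T *m _ *m pid_mx r]mulmxA pid_mx_id //.
  by rewrite subrr subr0 addrC subrK.
- by rewrite -/J mulmxDl -!mulmxA J0 JJ !mulmx0 addr0.
- by rewrite -/J mulmxDl -!mulmxA J0' J1 !mulmx0 add0r.
Qed.

Variables (f1 f2 : O).
Hypotheses (f1_neq0 : f1 != 0) (f2_neq0 : f2 != 0).
Hypothesis f12 : forall h, divides f1 (f2 * h) -> divides f1 h.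
Hypothesis f21 : forall h, divides f2 (f1 * h) -> divides f2 h.

Lemma divides_mx (g : O) m n (A : 'M[O]_(m, n)) :
  (forall i j, divides g (A i j)) -> exists B, A = g *: B.
Proof.
move=> gA; have /choice[c cP] : forall ij : 'I_m * 'I_n, exists c, A ij.1 ij.2 = c * g.
  by move=> ij; apply: gA.
exists (\matrix_(i, j) c (i, j)); apply/matrixP => i j.
by rewrite !mxE (cP (i, j)) mulrC.
Qed.

Lemma cancel_mx (g h : O) m n (A B : 'M[O]_(m, n)) :
  (forall x, divides g (h * x) -> divides g x) -> h *: A = g *: B ->
  exists C, A = g *: C.
Proof.
move=> gh /matrixP AB; apply: divides_mx => i j; apply: gh.
by have := AB i j; rewrite !mxE => ->; exists (B i j); rewrite mulrC.
Qed.

Section SaturatedMatrix.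
Variables (d : nat) (M : 'M[O]_d) (u : O).
Hypotheses (uu : u \is a GRing.unit) (detM : \det M = u * (f1 * f2)).
Hypothesis sat : forall i j, ideal_gen2 f1 f2 ((\adj M) i j).
Let N := \adj M.

Let u0 : u != 0. Proof. by apply: contraTneq uu => ->; rewrite unitr0. Qed.
Let c0 : u * (f1 * f2) != 0. Proof. by rewrite !mulf_neq0. Qed.
Let MN : M *m N = (u * (f1 * f2))%:M. Proof. by rewrite -detM mul_mx_adj. Qed.
Let NM : N *m M = (u * (f1 * f2))%:M. Proof. by rewrite -detM mul_adj_mx. Qed.

Lemma saturated_projection : exists P A B : 'M[O]_d,
  N *m P = f2 *: B /\ N *m (1%:M - P) = f1 *: A.
Proof.
have [A [B NE]] : exists A B : 'M[O]_d, N = f1 *: A + f2 *: B.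
  have /choice[a aP] : forall ij : 'I_d * 'I_d, exists a, exists b, N ij.1 ij.2 = a * f1 + b * f2.
    by move=> ij; apply: sat.
  have /choice[b bP] := aP.
  exists (\matrix_(i, j) a (i, j)), (\matrix_(i, j) b (i, j)); apply/matrixP => i j.
  by have /= -> := bP (i, j); rewrite !mxE; ring.
have MAB : f1 *: (M *m A) + f2 *: (M *m B) = (u * (f1 * f2))%:M.
  by rewrite -MN NE mulmxDr !scalemxAr.
(* M N = u f1 f2 reads f2 (M B) = f1 (u f2 - M A), and f2 cancels modulo f1 entry by entry. *)
have [B' MB] : exists B', M *m B = f1 *: B'.
  apply: (@cancel_mx f1 f2 _ _ _ ((u * f2)%:M - M *m A) f12).
  rewrite scalerBr scale_scalar_mx mulrCA -MAB addrC addKr //.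
have [A' MA] : exists A', M *m A = f2 *: A'.
  apply: (@cancel_mx f2 f1 _ _ _ ((u * f1)%:M - M *m B) f21).
  by rewrite scalerBr scale_scalar_mx mulrCA [f2 * f1]mulrC -MAB addrK.
have AB' : A' + B' = u%:M.
  apply: (scalemx_inj (mulf_neq0 f1_neq0 f2_neq0)).
  by rewrite scale_scalar_mx [in RHS]mulrC -MAB MA MB scalerDr !scalerA [f2 * f1]mulrC.
have NB' : N *m B' = (u * f2) *: B.
  apply: (scalemx_inj f1_neq0); rewrite scalemxAr -MB mulmxA NM mul_scalar_mx.
  by rewrite scalerA; congr (_ *: _); ring.
have NA' : N *m A' = (u * f1) *: A.
  apply: (scalemx_inj f2_neq0); rewrite scalemxAr -MA mulmxA NM mul_scalar_mx.
  by rewrite scalerA; congr (_ *: _); ring.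
pose P := u^-1 *: B'; pose Q := u^-1 *: A'.
have QE : Q = 1%:M - P.
  apply/eqP; rewrite eq_sym subr_eq /P /Q -scalerDr AB' scale_scalar_mx mulVr //.
have NP : N *m P = f2 *: B by rewrite -scalemxAr NB' scalerA mulKr.
have NQ : N *m Q = f1 *: A by rewrite -scalemxAr NA' scalerA mulKr.
by exists P, A, B; rewrite -QE.
Qed.

Lemma saturated_block_decomposition : (forall i j, ev (M i j) = 0) ->
  exists d1 d2 (e : (d1 + d2)%N = d) (M1 : 'M[O]_d1) (M2 : 'M[O]_d2),
    [/\ (forall i j, ev (M1 i j) = 0) /\ (forall i j, ev (M2 i j) = 0),
        exists2 u1, u1 \is a GRing.unit & \det M1 = u1 * f1,
        exists2 u2, u2 \is a GRing.unit & \det M2 = u2 * f2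
      & loc_equiv M (castmx (e, e) (block_mx M1 0 0 M2))].
Proof.
move=> M0; have detM0 : \det M != 0 by rewrite detM.
have [P [A [B [NP]]]] := saturated_projection.
set Q := 1%:M - P => NQ; have QE : Q = 1%:M - P by [].
have PQ_comm : P *m Q = Q *m P by rewrite QE mulmxBr mulmxBl mulmx1 mul1mx.
clearbody Q.
(* f2 (B Q) = N P Q = N Q P = f1 (A P), and f2 cancels; P Q then lies in the image of M. *)
have [Z BQ] : exists Z, B *m Q = f1 *: Z.
  apply: (@cancel_mx f1 f2 _ _ _ (A *m P) f12).
  by rewrite !scalemxAl -NP -NQ -!mulmxA PQ_comm.
have PQ : P *m Q = u^-1 *: (M *m Z).
  have E : (u * (f1 * f2)) *: (P *m Q) = (f1 * f2) *: (M *m Z).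
    rewrite -mul_scalar_mx -MN !mulmxA -(mulmxA M N P) NP -scalemxAr -scalemxAl.
    by rewrite -mulmxA BQ -scalemxAr scalerA [f2 * f1]mulrC.
  apply: (scalemx_inj c0); rewrite E scalerA; congr (_ *: _).
  by rewrite mulrAC divrr // mul1r.
have evM : map_mx ev M = 0 by apply/matrixP => i j; rewrite !mxE M0.
have Pid : map_mx ev P *m map_mx ev P = map_mx ev P.
  have : map_mx ev (P *m Q) = 0 by rewrite PQ map_mxZ map_mxM evM mul0mx scaler0.
  by rewrite QE mulmxBr mulmx1 map_mxB map_mxM => /subr0_eq.
have [r [C [X [rd uC CJ CK]]]] := adapted_frame Pid.
set J : 'M[O]_d := pid_mx r in CJ CK; set K := 1%:M - J in CK.
have JJ : J *m J = J by apply: pid_mx_id.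
pose B1 := B *m X *m J; pose A2 := A *m X *m K.
have f2B1 : f2 *: B1 = N *m C *m J by rewrite -mulmxA CJ !mulmxA NP -!scalemxAl.
have f1A2 : f1 *: A2 = N *m C *m K by rewrite -mulmxA CK -QE !mulmxA NQ -!scalemxAl.
pose M' := invmx C *m M.
have M'NC : M' *m (N *m C) = (u * (f1 * f2))%:M.
  rewrite /M' -mulmxA [M *m _]mulmxA MN mul_scalar_mx -scalemxAr mulVmx //.
  by rewrite scale_scalar_mx mulr1.
have NCM' : N *m C *m M' = (u * (f1 * f2))%:M by rewrite mulmxA mulmxK.
have M'B1 : M' *m B1 = (u * f1) *: J.
  apply: (scalemx_inj f2_neq0); rewrite scalemxAr f2B1 mulmxA M'NC mul_scalar_mx.
  by rewrite scalerA; congr (_ *: _); ring.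
have M'A2 : M' *m A2 = (u * f2) *: K.
  apply: (scalemx_inj f1_neq0); rewrite scalemxAr f1A2 mulmxA M'NC mul_scalar_mx.
  by rewrite scalerA; congr (_ *: _); ring.
have NCE : f2 *: B1 + f1 *: A2 = N *m C by rewrite f2B1 f1A2 -mulmxDr addrC subrK mulmx1.
(* By (f2 B1 + f1 A2) M' = u f1 f2, f1 divides f2 B1 M', and f2 cancels. *)
have [E' B1M'] : exists E', B1 *m M' = f1 *: E'.
  apply: (@cancel_mx f1 f2 _ _ _ ((u * f2)%:M - A2 *m M') f12).
  rewrite scalerBr scale_scalar_mx mulrCA -NCM' -NCE mulmxDl -!scalemxAl.
  by rewrite addrK.
(* M' B1 = u f1 J gives M' e = J M' after cancelling u f1; as M' is injective, e is idempotent over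
   O itself. *)
pose e := u^-1 *: E'.
have M'e : M' *m e = J *m M'.
  apply: (scalemx_inj (mulf_neq0 u0 f1_neq0)); rewrite [RHS]scalemxAl -M'B1 -(mulmxA M') B1M'.
  by rewrite /e -!scalemxAr scalerA mulrAC divrr // mul1r.
have detM'0 : \det M' != 0.
  rewrite det_mulmx det_inv mulf_neq0 //; apply: contraTneq uC.
  by rewrite unitmxE -unitrV => ->; rewrite unitr0.
have ee : e *m e = e.
  by apply: (mulmx_det_inj detM'0); rewrite mulmxA M'e -mulmxA M'e mulmxA JJ.
(* For an exact idempotent the adapted frame satisfies e D = D J2 over O, not only at the origin. *)
have [r2 [D [Y [r2d uD DJ DK]]]] : exists r2 (D Y : 'M[O]_d), let J2 := pid_mx r2 : 'M[O]_d in
    [/\ (r2 <= d)%N, D \in unitmx, D *m J2 = e *m Y *m J2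
      & D *m (1%:M - J2) = (1%:M - e) *m Y *m (1%:M - J2)].
  by apply: adapted_frame; rewrite -map_mxM ee.
set J2 : 'M[O]_d := pid_mx r2 in DJ DK.
have eD : e *m D = D *m J2.
  have DE : D = D *m J2 + D *m (1%:M - J2) by rewrite -mulmxDr addrC subrK mulmx1.
  rewrite {1}DE mulmxDr DJ DK !mulmxA ee.
  have -> : e *m (1%:M - e) = 0 by rewrite mulmxBr mulmx1 ee subrr.
  by rewrite !mul0mx addr0.
clearbody e.
pose M2 := M' *m D.
have M2J2 : M2 *m J2 = J *m M2 by rewrite -mulmxA -eD mulmxA M'e -mulmxA.
have detM2 : \det M2 = \det (invmx C) * \det D * \det M.
  by rewrite !det_mulmx; ring.
have udet : \det (invmx C) * \det D \is a GRing.unit.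
  by rewrite unitrM det_inv unitrV -!unitmxE uC.
have detM20 : \det M2 != 0.
  by rewrite detM2 mulf_neq0 //; apply: contraTneq udet => ->; rewrite unitr0.
(* The two traces are the determinant of [M2] times r2 and times r, by cyclicity; characteristic
   zero recovers the ranks from their images in k. *)
have r2r : r2 = r.
  have : \tr (\adj M2 *m (M2 *m J2)) = \tr (\adj M2 *m (J *m M2)) by rewrite M2J2.
  rewrite mulmxA mul_adj_mx [RHS]mxtrace_mulC -mulmxA mul_mx_adj mul_scalar_mx.
  rewrite mul_mx_scalar !mxtraceZ !mxtrace_pid // => /(mulfI detM20).
  by move=> /(congr1 ev); rewrite !rmorph_nat => /(natr_inj_pchar0 pchar_k).
move: rd; rewrite /J => rd; rewrite /J2 /J r2r in M2J2.
have [d2 [e0 [N1 [N2 M2E]]]] := commute_pid_block rd M2J2.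
have [x N1x] : exists x, \det N1 * x = (u * f1) ^+ r.
  by apply: (@diag_block_detl _ _ _ _ e0 N1 N2 (invmx D *m B1)); rewrite -M2E /M2 mulmxA mulmxK.
have [y N2y] : exists y, \det N2 * y = (u * f2) ^+ d2.
  by apply: (@diag_block_detr _ _ _ _ e0 N1 N2 (invmx D *m A2)); rewrite -M2E /M2 mulmxA mulmxK.
have detN : \det N1 * \det N2 = \det (invmx C) * \det D * u * (f1 * f2).
  by rewrite -mulrA -detM -detM2 M2E det_diag_block.
have evM2 i j : ev (M2 i j) = 0.
  have : map_mx ev M2 = 0 by rewrite !map_mxM evM mulmx0 mul0mx.
  by move=> /matrixP /(_ i j); rewrite [LHS]mxE [RHS]mxE.
(* f1 divides det N1 det N2, and det N2 divides a power of u f2, so it cancels modulo f1. *)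
have [h1 h1E] : divides f1 (\det N1).
  apply: (divides_cancel_factor uu f12 N2y); rewrite detN.
  by exists (\det (invmx C) * \det D * u * f2); ring.
have [h2 h2E] : divides f2 (\det N2).
  apply: (divides_cancel_factor uu f21 N1x); rewrite [_ * _]mulrC detN.
  by exists (\det (invmx C) * \det D * u * f1); ring.
have uh : h1 * h2 \is a GRing.unit.
  suff -> : h1 * h2 = \det (invmx C) * \det D * u by rewrite unitrM udet.
  apply: (mulIf (mulf_neq0 f1_neq0 f2_neq0)); rewrite -detN h1E h2E; ring.
move: uh; rewrite unitrM => /andP[uh1 uh2].
exists r, d2, e0, N1, N2; split.
- by apply: (@diag_block_entries _ _ _ _ e0 _ _ (fun z => ev z = 0)); rewrite -M2E.
- by exists h1.
- by exists h2.
- by exists (invmx C), D; rewrite -M2E unitmx_inv.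
Qed.

End SaturatedMatrix.

(** Local equivalence changes the adjugate by invertible factors on both sides and a unit, so the
    ideal condition is a matter of the block matrix. *)
Lemma block_decomposition_saturated d (M : 'M[O]_d) d1 d2 (e : (d1 + d2)%N = d)
    (M1 : 'M[O]_d1) (M2 : 'M[O]_d2) (u1 u2 : O) : \det M != 0 ->
  \det M1 = u1 * f1 -> \det M2 = u2 * f2 ->
  loc_equiv M (castmx (e, e) (block_mx M1 0 0 M2)) ->
  forall i j, ideal_gen2 f1 f2 ((\adj M) i j).
Proof.
move=> detM detM1 detM2 [A [B [uA uB KE]]].
have [K1 [K2 KK]] : exists K1 K2 : 'M[O]_d,
    castmx (e, e) (block_mx M1 0 0 M2) *m (f1 *: K1 + f2 *: K2)
    = (\det (castmx (e, e) (block_mx M1 0 0 M2)))%:M.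
  rewrite det_diag_block detM1 detM2; case: d / e {M A B detM uA uB KE}.
  (* The two blocks of the adjugate of the block matrix: det M2 adj M1 carries f2, and det M1 adj M2
     carries f1. *)
  exists (block_mx 0 0 0 (u1 *: \adj M2)), (block_mx (u2 *: \adj M1) 0 0 0).
  rewrite castmx_id !scale_block_mx !scaler0 add_block_mx !addr0 !add0r mulmx_block.
  rewrite !mulmx0 !mul0mx !addr0 !add0r -!scalemxAr !mul_mx_adj detM1 detM2.
  rewrite !scale_scalar_mx scalar_mx_block.
  by congr block_mx; congr (_%:M); ring.
have [w uw NE] : exists2 w, w \is a GRing.unit & \adj M = w *: (B *m (f1 *: K1 + f2 *: K2) *m A).
  exists (\det A * \det B)^-1; first by rewrite unitrV unitrM -!unitmxE uA.
  have uAB : \det A * \det B \is a GRing.unit by rewrite unitrM -!unitmxE uA.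
  apply: (mulmx_det_inj detM); rewrite mul_mx_adj -scalemxAr.
  have -> : M *m (B *m (f1 *: K1 + f2 *: K2) *m A)
      = invmx A *m (A *m M *m B *m (f1 *: K1 + f2 *: K2)) *m A.
    by rewrite !mulmxA mulVmx // mul1mx.
  rewrite -KE KK KE !det_mulmx mul_mx_scalar -scalemxAl mulVmx // scalerA.
  rewrite scale_scalar_mx mulr1; congr (_%:M).
  have -> : \det A * \det M * \det B = \det A * \det B * \det M by ring.
  by rewrite mulKr.
move=> i j; exists ((w *: (B *m K1 *m A)) i j), ((w *: (B *m K2 *m A)) i j).
rewrite NE mulmxDr mulmxDl -!scalemxAr -!scalemxAl scalerDr !scalerA.
by rewrite mxE [in LHS]mxE [in X in _ + X]mxE [in RHS]mxE [in X in _ = _ + X]mxE; ring.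
Qed.

End BlockDecomposition.

(** * The kernel module *)

Section TensorUniversal.
Variables (R S : comPzRingType) (phi : {rmorphism R -> S}) (E : lmodType R).
Variables (V : lmodType S) (g : E -> V).
Hypothesis gD : forall x y, g (x + y) = g x + g y.
Hypothesis gZ : forall r x, g (r *: x) = phi r *: g x.

Let ev0 : {freeg (E * S)%type / int} -> V :=
  fglift (fun x : E * S => x.2 *: g x.1 : zmodule V).

Let ev0B : zmod_morphism ev0.
Proof. exact: (@lift_is_additive _ _ (zmodule V)). Qed.
HB.instance Definition _ := GRing.isZmodMorphism.Build _ _ ev0 ev0B.

Let ev0_gen e s : ev0 << (e, s) >> = s *: g e.
Proof. by rewrite /ev0 liftU scale1r. Qed.

Let ev0_span x : Defs.span (@tens_rel R S phi E) x -> ev0 x = 0.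
Proof.
move=> sx; apply: (sx (fun x => ev0 x = 0)).
- exact: raddf0.
- move=> c a b a0 b0; rewrite raddfD /= b0 addr0 -[c]intz scaler_int raddfMz /= a0.
  by rewrite mul0rz.
move=> _ [e e' s|e s s'|r e s]; rewrite !raddfB /= !ev0_gen.
- by rewrite gD scalerDr addrAC addrK subrr.
- by rewrite scalerDl addrAC addrK subrr.
- by rewrite gZ scalerA mulrC subrr.
Qed.

Lemma tensor_universal : exists T : tensor phi E -> V,
  [/\ forall x y, T (x - y) = T x - T y, forall a x, T (a *: x) = a *: T x
    & forall e s, T (tens phi e s) = s *: g e].
Proof.
pose T (x : tensor phi E) := ev0 (mrepr x).
have TE y : T (mclass (@tens_rel R S phi E) y) = ev0 y.
  have := ev0_span (@mclass_repr _ _ (@tens_rel R S phi E) y).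
  by rewrite raddfB => /eqP; rewrite subr_eq0 => /eqP.
have Tt e s : T (tens phi e s) = s *: g e by rewrite /tens TE ev0_gen.
have TB x y : T (x - y) = T x - T y by rewrite -[x]mreprK -[y]mreprK -raddfB !TE raddfB.
exists T; split=> // a x; elim/tens_ind: x => [|e s|x y IHx IHy].
- have T0 : T 0 = 0 by rewrite -(subrr 0) TB subrr.
  by rewrite scaler0 T0 scaler0.
- by rewrite -[a *: _]/(tens_scale _ _) tens_scale_tens !Tt scalerA.
by rewrite scalerBr !TB IHx IHy scalerBr.
Qed.

(** The induced map into a torsion-free module kills torsion. This turns equalities of classes of
    tensors into equalities of column vectors. *)
Lemma mod_torsion_eq : (forall s (w : V), GRing.lreg s -> s *: w = 0 -> w = 0) ->
  forall e e' s s',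
  mclass (@torsion S (tensor phi E)) (tens phi e s)
    = mclass (@torsion S (tensor phi E)) (tens phi e' s') ->
  s *: g e = s' *: g e'.
Proof.
move=> Vtf e e' s s' /mclass_eq/torsion_span[t lt tx].
have [T [TB TZ Tt]] := tensor_universal; apply/eqP; rewrite -subr_eq0 -!Tt -TB.
apply/eqP/(Vtf t) => //; rewrite -TZ tx.
by rewrite -(subrr 0) TB subrr.
Qed.

End TensorUniversal.

Section NaturalMap.
Variables (R S : comPzRingType) (phi : {rmorphism R -> S}) (E : lmodType R).

Lemma tens0l s : tens phi (0 : E) s = 0.
Proof. by apply: (addrI (tens phi 0 s)); rewrite addr0 -tensDl addr0. Qed.

Lemma mod_torsion_eq0 (x : tensor phi E) s :
  GRing.lreg s -> s *: x = 0 -> mclass (@torsion S (tensor phi E)) x = 0.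
Proof.
move=> ls sx; rewrite -(raddf0 (mclass (@torsion S (tensor phi E)))).
by apply/mclass_eq/torsion_span; rewrite subr0; exists s.
Qed.

HB.instance Definition _ := GRing.isLinear.Build R E (restr phi (pull_mod_torsion phi E))
  *:%R (natural_map phi (E := E)) (@natural_map_linear R S phi E).

Lemma natural_mapZ r e :
  natural_map phi (r *: e) = mclass (@torsion S (tensor phi E)) (tens phi e (phi r)).
Proof. by rewrite /natural_map tensZl mulr1. Qed.

(** Pure tensors generate the tensor product additively, so it is enough to reach their classes. *)
Lemma natural_map_surj (x : restr phi (pull_mod_torsion phi E)) :
  (forall e s, exists e', natural_map phi e' = mclass (@torsion S (tensor phi E)) (tens phi e s)) ->
  exists e, natural_map phi e = x.
Proof.
move=> gens; rewrite -[x]mreprK; elim/tens_ind: (mrepr x) => [|e s|y z [ey Ey] [ez Ez]].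
- by exists 0; rewrite !raddf0.
- exact: gens.
by exists (ey - ez); rewrite !raddfB /= Ey Ez.
Qed.

End NaturalMap.

(** * Decomposing the kernel module along the components *)

Section KernelModuleSplitting.
Variables (O : idomainType) (f1 f2 : O).
Hypotheses (f1_neq0 : f1 != 0) (f2_neq0 : f2 != 0).
Hypothesis f12 : forall h, divides f1 (f2 * h) -> divides f1 h.
Hypothesis f21 : forall h, divides f2 (f1 * h) -> divides f2 h.
Notation f := (f1 * f2).
Notation S := (rquot f).
Notation S1 := (rquot f1).
Notation S2 := (rquot f2).
Notation r1 := (res1 f1 f2).
Notation r2 := (res2 f1 f2).

Lemma rclass_eq0 (g x : O) : rclass g x = 0 <-> divides g x.
Proof.
rewrite -(raddf0 (rclass g)) rclass_eq subr0; split=> -[c ->]; by exists c.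
Qed.

Lemma res1E x : r1 (rclass f x) = rclass f1 x. Proof. exact: rresE. Qed.
Lemma res2E x : r2 (rclass f x) = rclass f2 x. Proof. exact: rresE. Qed.

(** What f1 kills in O/(f1 f2) are the multiples of f2, the functions vanishing on X_2; so f1 e = 0
    means that e is supported on X_1. *)
Lemma annihilator_f1 (x : S) : rclass f f1 * x = 0 <-> r2 x = 0.
Proof.
rewrite -[x]rreprK -rmorphM res2E !rclass_eq0; split=> -[c cE].
  by exists c; apply: (mulfI f1_neq0); rewrite cE; ring.
by exists c; rewrite cE; ring.
Qed.

Lemma annihilator_f2 (x : S) : rclass f f2 * x = 0 <-> r1 x = 0.
Proof.
rewrite -[x]rreprK -rmorphM res1E !rclass_eq0; split=> -[c cE].
  by exists c; apply: (mulfI f2_neq0); rewrite cE; ring.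
by exists c; rewrite cE; ring.
Qed.

Lemma res_inj (x : S) : r1 x = 0 -> r2 x = 0 -> x = 0.
Proof.
rewrite -[x]rreprK res1E res2E !rclass_eq0 => -[a ->].
by rewrite mulrC => /f21[b ->]; exists b; ring.
Qed.

(** By coprimality f2 is a non-zero-divisor on X_1, so an element killed by f2 becomes torsion when
    restricted to X_1. *)
Lemma lreg_f2 : GRing.lreg (rclass f1 f2).
Proof.
move=> x y; rewrite -[x]rreprK -[y]rreprK -!rmorphM => /rclass_eq[c cE].
apply/rclass_eq/f12; by exists c; rewrite -cE mulrBr.
Qed.

Lemma lreg_f1 : GRing.lreg (rclass f2 f1).
Proof.
move=> x y; rewrite -[x]rreprK -[y]rreprK -!rmorphM => /rclass_eq[c cE].
apply/rclass_eq/f21; by exists c; rewrite -cE mulrBr.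
Qed.

Section Kernel.
Variables (d : nat) (M : 'M[O]_d).
Notation E := (kernel_module f M).
Notation cls := (map_mx (rclass f)).

Lemma kernel_moduleP (e : E) : exists c : 'cV[O]_d, kernel_val e = cls (\adj M *m c).
Proof.
case: e => w /=; rewrite unfold_in => /asboolP[c ->].
exists (map_mx (@rrepr O f) c); rewrite map_mxM; congr (_ *m _).
by apply/matrixP => i j; rewrite !mxE; apply/esym/rreprK.
Qed.

Lemma kernel_module_col (c : 'cV[O]_d) : exists e : E, kernel_val e = cls (\adj M *m c).
Proof.
have cE : cls (\adj M *m c) \in @in_kernel O f d M.
  by rewrite unfold_in; apply/asboolP; exists (cls c); rewrite map_mxM.
by exists (KernelModule cE).
Qed.

Lemma kernel_valD (x y : E) : kernel_val (x + y) = kernel_val x + kernel_val y.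
Proof. exact: (raddfD val). Qed.

Lemma kernel_valZ a (x : E) : kernel_val (a *: x) = a *: kernel_val x.
Proof. by []. Qed.

Lemma kernel_val_inj : injective (@kernel_val O f d M).
Proof. exact: val_inj. Qed.

Lemma kernel_annihilated1 (e : E) :
  rclass f f1 *: e = 0 <-> map_mx r2 (kernel_val e) = 0.
Proof.
split=> [e0|/matrixP e0].
  apply/matrixP => i j; rewrite [LHS]mxE [RHS]mxE; apply/annihilator_f1.
  by have := congr1 (fun x : E => kernel_val x i j) e0; rewrite kernel_valZ mxE => ->; rewrite mxE.
apply: kernel_val_inj; rewrite kernel_valZ; apply/matrixP => i j.
by rewrite mxE [RHS]mxE; apply/annihilator_f1; have := e0 i j; rewrite !mxE.
Qed.

Lemma kernel_annihilated2 (e : E) :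
  rclass f f2 *: e = 0 <-> map_mx r1 (kernel_val e) = 0.
Proof.
split=> [e0|/matrixP e0].
  apply/matrixP => i j; rewrite [LHS]mxE [RHS]mxE; apply/annihilator_f2.
  by have := congr1 (fun x : E => kernel_val x i j) e0; rewrite kernel_valZ mxE => ->; rewrite mxE.
apply: kernel_val_inj; rewrite kernel_valZ; apply/matrixP => i j.
by rewrite mxE [RHS]mxE; apply/annihilator_f2; have := e0 i j; rewrite !mxE.
Qed.

Lemma kernel_res_inj (e e' : E) :
  map_mx r1 (kernel_val e) = map_mx r1 (kernel_val e') ->
  map_mx r2 (kernel_val e) = map_mx r2 (kernel_val e') -> e = e'.
Proof.
move=> /matrixP E1 /matrixP E2; apply: kernel_val_inj; apply/matrixP => i j.
apply/eqP; rewrite -subr_eq0; apply/eqP; apply: res_inj; rewrite rmorphB.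
  by have := E1 i j; rewrite !mxE => ->; rewrite subrr.
by have := E2 i j; rewrite !mxE => ->; rewrite subrr.
Qed.

(* E is the sum of the parts supported on X_1 and on X_2. *)
Definition kernel_decomposes := forall e : E, exists e1 e2 : E,
  [/\ e = e1 + e2, rclass f f1 *: e1 = 0 & rclass f f2 *: e2 = 0].

Lemma kernel_decomposes_saturated (u : O) : u \is a GRing.unit -> \det M = u * f ->
  (forall i j, ideal_gen2 f1 f2 ((\adj M) i j)) -> kernel_decomposes.
Proof.
move=> uu detM sat e; have [c ce] := kernel_moduleP e.
have [P [A [B [NP NQ]]]] := saturated_projection f1_neq0 f2_neq0 f12 f21 uu detM sat.
have [e1 e1E] := kernel_module_col (P *m c).
have [e2 e2E] := kernel_module_col ((1%:M - P) *m c).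
exists e1, e2; split.
- apply: kernel_val_inj; rewrite kernel_valD ce e1E e2E -map_mxD -mulmxDr -mulmxDl.
  by rewrite addrC subrK mul1mx.
- apply/kernel_annihilated1; rewrite e1E mulmxA NP; apply/matrixP => i j.
  rewrite -scalemxAl [LHS]mxE [X in r2 X]mxE [RHS]mxE res2E; apply/rclass_eq0.
  by rewrite mxE; exists ((B *m c) i j); rewrite mulrC.
apply/kernel_annihilated2; rewrite e2E mulmxA NQ; apply/matrixP => i j.
rewrite -scalemxAl [LHS]mxE [X in r1 X]mxE [RHS]mxE res1E; apply/rclass_eq0.
by rewrite mxE; exists ((A *m c) i j); rewrite mulrC.
Qed.

(** Applied to a column of the adjugate: its two parts are multiples of f2 and of f1, and lifting
    the equality to O costs a multiple of f1 f2. *)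
Lemma ideal_of_kernel_decomposes : kernel_decomposes ->
  forall i j, ideal_gen2 f1 f2 ((\adj M) i j).
Proof.
move=> dec i j; have [e eE] := kernel_module_col (delta_mx j 0).
have [e1 [e2 [e12 /kernel_annihilated1/matrixP a1 /kernel_annihilated2/matrixP a2]]] := dec e.
have := congr1 (fun x : E => kernel_val x i 0) e12.
rewrite kernel_valD eE mxE -colE mxE [in RHS]mxE.
have := a1 i 0; have := a2 i 0; rewrite !mxE.
rewrite -[kernel_val e1 i 0]rreprK -[kernel_val e2 i 0]rreprK res1E res2E.
move=> /rclass_eq0[a ->] /rclass_eq0[b ->]; rewrite -rmorphD => /rclass_eq[c cE].
exists (a + c * f2), b; rewrite -[LHS](subrK (b * f2 + a * f1)) cE; ring.
Qed.

Definition restrict1 (e : E) : 'cV[S1]_d := map_mx r1 (kernel_val e).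
Definition restrict2 (e : E) : 'cV[S2]_d := map_mx r2 (kernel_val e).

Lemma restrict1D x y : restrict1 (x + y) = restrict1 x + restrict1 y.
Proof. by rewrite /restrict1 kernel_valD map_mxD. Qed.
Lemma restrict2D x y : restrict2 (x + y) = restrict2 x + restrict2 y.
Proof. by rewrite /restrict2 kernel_valD map_mxD. Qed.
Lemma restrict1Z a x : restrict1 (a *: x) = r1 a *: restrict1 x.
Proof. by rewrite /restrict1 kernel_valZ map_mxZ. Qed.
Lemma restrict2Z a x : restrict2 (a *: x) = r2 a *: restrict2 x.
Proof. by rewrite /restrict2 kernel_valZ map_mxZ. Qed.

Lemma colvec_torsion_free (T : comPzRingType) n s (w : 'cV[T]_n) :
  GRing.lreg s -> s *: w = 0 -> w = 0.
Proof.
move=> ls /matrixP sw; apply/matrixP => i j; apply: ls.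
by have := sw i j; rewrite !mxE mulr0.
Qed.

Lemma kernel_split_map_inj (e e' : E) :
  natural_map r1 e = natural_map r1 e' -> natural_map r2 e = natural_map r2 e' -> e = e'.
Proof.
move=> E1 E2; apply: kernel_res_inj.
  have := mod_torsion_eq restrict1D restrict1Z (@colvec_torsion_free _ d) E1.
  by rewrite !scale1r.
have := mod_torsion_eq restrict2D restrict2Z (@colvec_torsion_free _ d) E2.
by rewrite !scale1r.
Qed.

Lemma restriction1_surj (x : restr r1 (pull_mod_torsion r1 E)) :
  exists e, natural_map r1 e = x.
Proof.
apply: natural_map_surj => e s; exists (rclass f (rrepr s) *: e).
by rewrite natural_mapZ res1E rreprK.
Qed.

Lemma restriction2_surj (x : restr r2 (pull_mod_torsion r2 E)) :
  exists e, natural_map r2 e = x.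
Proof.
apply: natural_map_surj => e s; exists (rclass f (rrepr s) *: e).
by rewrite natural_mapZ res2E rreprK.
Qed.

Lemma restriction1_eq0 (e : E) : rclass f f2 *: e = 0 -> natural_map r1 e = 0.
Proof.
move=> fe; apply: (mod_torsion_eq0 (s := rclass f1 f2)); first exact: lreg_f2.
rewrite -[_ *: _]/(tens_scale _ _) tens_scale_tens mulr1.
by rewrite -[rclass f1 f2]mulr1 -res1E -tensZl fe tens0l.
Qed.

Lemma restriction2_eq0 (e : E) : rclass f f1 *: e = 0 -> natural_map r2 e = 0.
Proof.
move=> fe; apply: (mod_torsion_eq0 (s := rclass f2 f1)); first exact: lreg_f1.
rewrite -[_ *: _]/(tens_scale _ _) tens_scale_tens mulr1.
by rewrite -[rclass f2 f1]mulr1 -res2E -tensZl fe tens0l.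
Qed.

Definition split_map (e : E) : (comp1 E * comp2 E)%type :=
  (natural_map r1 e, natural_map r2 e).

Fact split_map_linear : linear split_map.
Proof.
move=> a x y; exact: (congr2 pair (@natural_map_linear _ _ r1 E a x y)
  (@natural_map_linear _ _ r2 E a x y)).
Qed.
HB.instance Definition _ := GRing.isLinear.Build S E (comp1 E * comp2 E)%type
  *:%R split_map split_map_linear.

Lemma inj_surj_bijective (T U : Type) (h : T -> U) :
  injective h -> (forall y, exists x, h x = y) -> bijective h.
Proof.
move=> h_inj /choice[g gP]; exists g => // x.
by apply: h_inj; rewrite gP.
Qed.

Lemma kernel_decomposes_splits : kernel_decomposes -> splits (E : lmodType S).
Proof.
move=> dec; exists split_map; apply: inj_surj_bijective => [x y [E1 E2]|[x1 x2]].
  exact: kernel_split_map_inj E1 E2.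
have [e1 e1E] := restriction1_surj x1; have [e2 e2E] := restriction2_surj x2.
have [a1 [a2 [aE fa1 fa2]]] := dec e1; have [b1 [b2 [bE fb1 fb2]]] := dec e2.
(* [a1] has image x1 on X_1 and vanishes on X_2; [b2] has image x2 on X_2 and vanishes on X_1. *)
exists (a1 + b2); congr pair.
  by rewrite -e1E aE !raddfD /= !(restriction1_eq0 fb2) (restriction1_eq0 fa2).
by rewrite -e2E bE !raddfD /= !(restriction2_eq0 fb1) (restriction2_eq0 fa1).
Qed.

(** f1 kills [comp1] and f2 kills [comp2], so the coordinates of [h e], pulled back along the
    isomorphism, decompose e. *)
Lemma splits_kernel_decomposes : splits (E : lmodType S) -> kernel_decomposes.
Proof.
move=> [h [g hK gK]] e.
have gZ a x : g (a *: x) = a *: g x by apply: (can_inj hK); rewrite linearZ /= !gK.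
have gD x y : g (x + y) = g x + g y by apply: (can_inj hK); rewrite linearD /= !gK.
have g0 : g 0 = 0 by apply: (can_inj hK); rewrite linear0 gK.
exists (g ((h e).1, 0)), (g (0, (h e).2)); split.
- rewrite -gD -[LHS]hK; congr g; rewrite [LHS]surjective_pairing.
  by congr pair; rewrite ?addr0 ?add0r.
- rewrite -gZ -[RHS]g0; congr g; congr pair; last exact: scaler0.
  rewrite -[LHS]/(r1 (rclass f f1) *: ((h e).1 : mod_torsion (tensor r1 E))) res1E.
  have -> : rclass f1 f1 = 0 by apply/rclass_eq0; exists 1; rewrite mul1r.
  exact: (@scale0r S1 (mod_torsion (tensor r1 E)) (h e).1).
rewrite -gZ -[RHS]g0; congr g; congr pair; first exact: scaler0.
rewrite -[LHS]/(r2 (rclass f f2) *: ((h e).2 : mod_torsion (tensor r2 E))) res2E.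
have -> : rclass f2 f2 = 0 by apply/rclass_eq0; exists 1; rewrite mul1r.
exact: (@scale0r S2 (mod_torsion (tensor r2 E)) (h e).2).
Qed.

Lemma lreg_fst (s : (S1 * S2)%type) : GRing.lreg s -> GRing.lreg s.1.
Proof.
move=> ls x y xy; have E : s * (x, 0) = s * (y, 0) := congr2 pair xy (erefl _).
by case: (ls _ _ E).
Qed.

Lemma lreg_snd (s : (S1 * S2)%type) : GRing.lreg s -> GRing.lreg s.2.
Proof.
move=> ls x y xy; have E : s * (0, x) = s * (0, y) := congr2 pair (erefl _) xy.
by case: (ls _ _ E).
Qed.

(** Columns over O/f1 form a torsion-free module over the product ring through the first projection,
    since the components of a non-zero-divisor are non-zero-divisors. *)
Lemma pullback_restrict1 (e e' : E) s s' :
  mclass (@torsion _ (tensor (nu f1 f2) E)) (tens _ e s)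
    = mclass (@torsion _ (tensor (nu f1 f2) E)) (tens _ e' s') ->
  s.1 *: restrict1 e = s'.1 *: restrict1 e'.
Proof.
apply: (@mod_torsion_eq _ _ (nu f1 f2) E
  (restr (fst : {rmorphism (S1 * S2)%type -> S1}) 'cV[S1]_d) restrict1
  restrict1D restrict1Z) => t w lt.
exact: (colvec_torsion_free (lreg_fst lt)).
Qed.

Lemma pullback_restrict2 (e e' : E) s s' :
  mclass (@torsion _ (tensor (nu f1 f2) E)) (tens _ e s)
    = mclass (@torsion _ (tensor (nu f1 f2) E)) (tens _ e' s') ->
  s.2 *: restrict2 e = s'.2 *: restrict2 e'.
Proof.
apply: (@mod_torsion_eq _ _ (nu f1 f2) E
  (restr (snd : {rmorphism (S1 * S2)%type -> S2}) 'cV[S2]_d) restrict2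
  restrict2D restrict2Z) => t w lt.
exact: (colvec_torsion_free (lreg_snd lt)).
Qed.

(** Saturation lifts e tensor (1, 0) to an element of E that agrees with e on X_1 and vanishes on
    X_2. *)
Lemma saturated_kernel_decomposes : saturated (nu f1 f2) E -> kernel_decomposes.
Proof.
move=> [g _ gK] e.
have [e1 e1E] : exists e1, natural_map (nu f1 f2) e1
    = mclass (@torsion _ (tensor (nu f1 f2) E)) (tens _ e (1, 0)).
  by eexists; apply: gK.
exists e1, (e - e1); split; first by rewrite addrC subrK.
  apply/kernel_annihilated1; have := pullback_restrict2 e1E.
  by rewrite scale1r scale0r.
apply/kernel_annihilated2; have := pullback_restrict1 e1E; rewrite !scale1r => E1.
rewrite -[LHS]/(restrict1 _); apply: (addIr (restrict1 e1)).
by rewrite -restrict1D subrK add0r.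
Qed.

Lemma kernel_decomposes_nu_saturated : kernel_decomposes -> saturated (nu f1 f2) E.
Proof.
move=> dec; apply: inj_surj_bijective => [x y xy|x].
  apply: kernel_res_inj.
    by have := pullback_restrict1 xy; rewrite !scale1r.
  by have := pullback_restrict2 xy; rewrite !scale1r.
apply: natural_map_surj => e [s1 s2].
have [e1 [e2 [eE fe1 fe2]]] := dec e.
exists (rclass f (rrepr s1) *: e1 + rclass f (rrepr s2) *: e2).
rewrite raddfD /= !natural_mapZ eE tensDl raddfD; congr (_ + _).
  (* The difference is e1 tensor (0, t). It is killed by the non-zero-divisor (1, f1), because (1,
     f1) (0, t) = f1 (0, t) and f1 e1 = 0. *)
  apply/mclass_eq/torsion_span; exists (1, rclass f2 f1).
    move=> [a b] [a' b'] [/= ]; rewrite !mul1r => -> /lreg_f1 -> //.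
  have -> : tens (nu f1 f2) e1 (nu f1 f2 (rclass f (rrepr s1))) - tens _ e1 (s1, s2)
      = tens _ e1 (0, r2 (rclass f (rrepr s1)) - s2).
    apply/eqP; rewrite subr_eq -tensDr; apply/eqP; congr (tens _ _ _); congr pair.
      by rewrite add0r res1E rreprK.
    by rewrite subrK.
  rewrite -[_ *: _]/(tens_scale _ _) tens_scale_tens.
  have -> : (1, rclass f2 f1) * (0, r2 (rclass f (rrepr s1)) - s2)
      = nu f1 f2 (rclass f f1) * (0, r2 (rclass f (rrepr s1)) - s2).
    apply: (congr2 pair); first by rewrite /= !mulr0.
    exact: (congr1 (fun z => z * _) (esym (res2E f1))).
  by rewrite -tensZl fe1 tens0l.
apply/mclass_eq/torsion_span; exists (rclass f1 f2, 1).
  move=> [a b] [a' b'] [/= ]; rewrite !mul1r => /lreg_f2 -> -> //.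
have -> : tens (nu f1 f2) e2 (nu f1 f2 (rclass f (rrepr s2))) - tens _ e2 (s1, s2)
    = tens _ e2 (r1 (rclass f (rrepr s2)) - s1, 0).
  apply/eqP; rewrite subr_eq -tensDr; apply/eqP; congr (tens _ _ _); congr pair.
    by rewrite subrK.
  by rewrite add0r res2E rreprK.
rewrite -[_ *: _]/(tens_scale _ _) tens_scale_tens.
have -> : (rclass f1 f2, 1) * (r1 (rclass f (rrepr s2)) - s1, 0)
    = nu f1 f2 (rclass f f2) * (r1 (rclass f (rrepr s2)) - s1, 0).
  apply: (congr2 pair); last by rewrite /= !mulr0.
  exact: (congr1 (fun z => z * _) (esym (res1E f2))).
by rewrite -tensZl fe2 tens0l.
Qed.

End Kernel.

(** Testing g on (1, 0) gives r with g - r in (f1) and r in (f2). Conversely a f1 + b f2 acts on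
    (s1, s2) as b f2 s1 on X_1 and a f1 s2 on X_2, and the sum of these two is a common lift. *)
Lemma rel_adjointP (g : O) : rel_adjoint f1 f2 g <-> ideal_gen2 f1 f2 g.
Proof.
split=> [adj|[a [b ->]] [s1 s2]].
  have [r] := adj (1, 0); rewrite -[r]rreprK => -[].
  rewrite !res1E !res2E mulr1 mulr0.
  move=> /rclass_eq[a aE] /esym/rclass_eq0[b bE].
  by exists a, b; rewrite -aE -bE subrK.
exists (rclass f (b * f2 * rrepr s1 + a * f1 * rrepr s2)).
set r := b * f2 * rrepr s1 + a * f1 * rrepr s2.
have E1 : r1 (rclass f (a * f1 + b * f2)) * s1 = r1 (rclass f r).
  rewrite -{1}[s1]rreprK !res1E -rmorphM; apply/rclass_eq.
  by exists (a * rrepr s1 - a * rrepr s2); rewrite /r; ring.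
have E2 : r2 (rclass f (a * f1 + b * f2)) * s2 = r2 (rclass f r).
  rewrite -{1}[s2]rreprK !res2E -rmorphM; apply/rclass_eq.
  by exists (b * rrepr s2 - b * rrepr s1); rewrite /r; ring.
exact: (congr2 pair E1 E2).
Qed.

End KernelModuleSplitting.

(** * The equivalences *)

Section GermConstants.
Variables (R : realType) (k : fieldType) (v : complete_norm R k) (kd : series_kind) (n : nat).
Notation O := (germ_ring v kd n).

Fact at_origin_zmod : zmod_morphism (@at_origin R k v kd n).
Proof. by move=> f g; rewrite /at_origin germ_seriesB fps_coefB. Qed.
Fact at_origin_monoid : monoid_morphism (@at_origin R k v kd n).
Proof.
split=> [|f g]; rewrite /at_origin; first by rewrite germ_series1 fps_coef1 eqxx.
rewrite germ_seriesM -{1}[0%MM]addm0 fps_coefM_single // => c d /eqP.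
by rewrite addm0 mnmD_eq0 => /andP[->].
Qed.
HB.instance Definition _ :=
  GRing.isZmodMorphism.Build O k (@at_origin R k v kd n) at_origin_zmod.
HB.instance Definition _ :=
  GRing.isMonoidMorphism.Build O k (@at_origin R k v kd n) at_origin_monoid.

Definition germ_const (c : k) : O := germ_of v kd (fps_poly c%:MP).

Lemma germ_series_const c : germ_series (germ_const c) = fps_poly c%:MP.
Proof.
apply: germ_ofK; rewrite /germ_convergent; case: kd => //.
apply/convergent_weight_boundedP; exists 1 => //; exists (v c); apply: bounded_polyC.
by rewrite expr1n.
Qed.

Fact germ_const_zmod : zmod_morphism germ_const.
Proof.
move=> a b; apply: germ_series_inj.
by rewrite germ_seriesB !germ_series_const mpolyCB rmorphB.
Qed.
Fact germ_const_monoid : monoid_morphism germ_const.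
Proof.
split=> [|a b]; apply: germ_series_inj.
  by rewrite germ_series1 germ_series_const mpolyC1 rmorph1.
by rewrite germ_seriesM !germ_series_const mpolyCM rmorphM.
Qed.
HB.instance Definition _ := GRing.isZmodMorphism.Build k O germ_const germ_const_zmod.
HB.instance Definition _ := GRing.isMonoidMorphism.Build k O germ_const germ_const_monoid.

Lemma germ_constK : cancel germ_const (@at_origin R k v kd n).
Proof.
by move=> c; rewrite /at_origin germ_series_const fps_coef_poly mcoeffC eqxx mulr1.
Qed.

End GermConstants.

Definition block_splits (O : comUnitRingType) (k : fieldType) (ev : O -> k)
    (f1 f2 : O) d (M : 'M[O]_d) :=
  exists d1 d2 (e : (d1 + d2)%N = d) (M1 : 'M[O]_d1) (M2 : 'M[O]_d2),
    [/\ (forall i j, ev (M1 i j) = 0) /\ (forall i j, ev (M2 i j) = 0),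
        exists2 u1, u1 \is a GRing.unit & \det M1 = u1 * f1,
        exists2 u2, u2 \is a GRing.unit & \det M2 = u2 * f2
      & loc_equiv M (castmx (e, e) (block_mx M1 0 0 M2))].

Lemma saturation_criteria_idomain (O : idomainType) (k : fieldType)
    (ev : {rmorphism O -> k}) (cst : {rmorphism k -> O}) (f1 f2 : O)
    d (M : 'M[O]_d) (u : O) :
  cancel cst ev ->
  (forall x, (x \is a GRing.unit) = (ev x != 0)) -> [pchar k] =i pred0 ->
  f1 != 0 -> f2 != 0 ->
  (forall h, divides f1 (f2 * h) -> divides f1 h) ->
  (forall h, divides f2 (f1 * h) -> divides f2 h) ->
  u \is a GRing.unit -> \det M = u * (f1 * f2) -> (forall i j, ev (M i j) = 0) ->
  [/\ mx_saturated f1 f2 M <-> forall i j, ideal_gen2 f1 f2 ((\adj M) i j),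
      saturated (nu f1 f2) (kernel_module (f1 * f2) M)
        <-> forall i j, ideal_gen2 f1 f2 ((\adj M) i j),
      splits (kernel_module (f1 * f2) M)
        <-> forall i j, ideal_gen2 f1 f2 ((\adj M) i j)
    & block_splits ev f1 f2 M <-> forall i j, ideal_gen2 f1 f2 ((\adj M) i j)].
Proof.
move=> evK ev_unit pchar_k f10 f20 f12 f21 uu detM M0.
have detM0 : \det M != 0.
  by rewrite detM !mulf_neq0 //; apply: contraTneq uu => ->; rewrite unitr0.
split; split.
- by move=> sat i j; apply/rel_adjointP.
- by move=> sat i j; apply/rel_adjointP.
- by move=> /(saturated_kernel_decomposes f10 f20) /ideal_of_kernel_decomposes; apply.
- move=> /(kernel_decomposes_saturated f10 f20 f12 f21 uu detM).
  exact: kernel_decomposes_nu_saturated.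
- by move=> /splits_kernel_decomposes /ideal_of_kernel_decomposes; apply.
- move=> /(kernel_decomposes_saturated f10 f20 f12 f21 uu detM).
  exact: kernel_decomposes_splits.
- by move=> [d1 [d2 [e [M1 [M2 [_ [u1 _ D1] [u2 _ D2] eqM]]]]]];
    apply: (block_decomposition_saturated detM0 D1 D2 eqM).
move=> sat.
exact: (saturated_block_decomposition evK ev_unit pchar_k f10 f20 f12 f21 uu detM sat M0).
Qed.

(** The ring structure is opened so that the integral domain built on it keeps the same operations
    and the statement over domains applies by conversion. *)
Lemma saturation_criteria (O : comUnitRingType) (k : fieldType)
    (ev : {rmorphism O -> k}) (cst : {rmorphism k -> O}) (f1 f2 : O)
    d (M : 'M[O]_d) (u : O) :
  GRing.integral_domain_axiom O -> cancel cst ev ->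
  (forall x, (x \is a GRing.unit) = (ev x != 0)) -> [pchar k] =i pred0 ->
  f1 != 0 -> f2 != 0 ->
  (forall h, divides f1 (f2 * h) -> divides f1 h) ->
  (forall h, divides f2 (f1 * h) -> divides f2 h) ->
  u \is a GRing.unit -> \det M = u * (f1 * f2) -> (forall i j, ev (M i j) = 0) ->
  [/\ mx_saturated f1 f2 M <-> forall i j, ideal_gen2 f1 f2 ((\adj M) i j),
      saturated (nu f1 f2) (kernel_module (f1 * f2) M)
        <-> forall i j, ideal_gen2 f1 f2 ((\adj M) i j),
      splits (kernel_module (f1 * f2) M)
        <-> forall i j, ideal_gen2 f1 f2 ((\adj M) i j)
    & block_splits ev f1 f2 M <-> forall i j, ideal_gen2 f1 f2 ((\adj M) i j)].
Proof.
case: O ev cst f1 f2 M u => T c ev cst f1 f2 M u dom.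
pose O : idomainType := HB.pack T (GRing.ComUnitRing.Pack c)
  (GRing.ComUnitRing_isIntegral.Build (GRing.ComUnitRing.Pack c) dom).
exact: (@saturation_criteria_idomain O k ev cst f1 f2 d M u).
Qed.

Theorem theorem4p4 (R : realType) (k : closedFieldType)
    (v : complete_norm R k) (pchar_k : [pchar k] =i pred0)
    (kd : series_kind) (n : nat) (f1 f2 : germ_ring v kd n)
    (f1_germ : hypersurface_germ f1) (f2_germ : hypersurface_germ f2)
    (f1f2 : no_common_component f1 f2)
    (d : nat) (d_gt1 : (1 < d)%N) (M : 'M[germ_ring v kd n]_d)
    (M_rep : det_rep (f1 * f2) M) :
  (mx_saturated f1 f2 M <->
     forall i j, ideal_gen2 f1 f2 ((\adj M) i j))
  /\
  [<-> saturated (nu f1 f2) (kernel_module (f1 * f2) M);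
       mx_saturated f1 f2 M;
       splits (kernel_module (f1 * f2) M);
       mx_splits f1 f2 M].
Proof.
have [f10 f1_0] := f1_germ; have [f20 f2_0] := f2_germ; have [M0 [u uu detM]] := M_rep.
have f21 : no_common_component f2 f1 by move=> g g2 g1; apply: f1f2.
have [adj sat spl blk] := @saturation_criteria (germ_ring v kd n) k
  (@at_origin R k v kd n) (@germ_const R k v kd n) f1 f2 d M u
  (@germ_integral R k v kd n) (@germ_constK R k v kd n) (@germ_unitE R k v kd n)
  pchar_k f10 f20 (fun h => @germ_coprime_cancel R k v kd n f1 f10 f2 h f1f2)
  (fun h => @germ_coprime_cancel R k v kd n f2 f20 f1 h f21) uu detM M0.
split=> //; tfae.
- by move=> /sat /adj.
- by move=> /adj /spl.
- move=> /spl /blk [d1 [d2 [e [M1 [M2 [[z1 z2] D1 D2 eqM]]]]]].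
  by exists d1, d2, e, M1, M2.
move=> [d1 [d2 [e [M1 [M2 [[z1 D1] [z2 D2] eqM]]]]]]; apply/sat/blk.
by exists d1, d2, e, M1, M2.
Qed.
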